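(* Let $n,p$ be integers with $0<p\le n-p$. If $\mu=(\mu_1,\ldots,\mu_d)\vdash n$ is a partition with $\mu_i\ge p+1$ for all $i$, or if $\mu=[p,n-p]$, then the sequence $$B^0_{p,n}(\mu),\;B^1_{p,n}(\mu),\;B^2_{p,n}(\mu),\;\ldots$$ is log-concave and unimodal.
   Context: $\mathfrak{S}_n$ is the symmetric group on $[n]=\{1,\ldots,n\}$; $[p,n-p]$ denotes the partition of $n$ with the two parts $p$ and $n-p$; $\kappa(\pi)$ is the number of cycles of $\pi$ (fixed points included). A connected (labeled, rooted) bicolored map with $n$ edges is a triple $(\alpha,\beta,\gamma)$ of permutations in $\mathfrak{S}_n$ with $\gamma=\alpha\beta$ such that the group generated by $\alpha,\beta$ acts transitively on $[n]$. Its genus $g$ is defined by $\kappa(\alpha)+\kappa(\beta)-n+\kappa(\gamma)=2-2g$. $B^g_{p,n}(\mu)$ is the number of connected bicolored maps of genus $g$ with $\gamma$ of cycle-type $[p,n-p]$ and $\alpha$ of cycle-type $\mu$. A sequence of real numbers $s_0,s_1,s_2,\ldots$ is log-concave if $s_i^2\ge s_{i-1}s_{i+1}$ for all $i>0$, and unimodal if there is $m\ge0$ with $s_0\le\cdots\le s_m\ge s_{m+1}\ge\cdots$. *)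

(* Defs.v *)
From mathcomp Require Import all_boot all_order all_algebra all_fingroup.

Set Implicit Arguments.
Unset Strict Implicit.
Unset Printing Implicit Defensive.

Import Order.TTheory GRing.Theory Num.Theory.
Local Open Scope ring_scope.

(* A partition of n is the weakly decreasing list of its positive parts. *)
Definition is_partition (n : nat) (mu : seq nat) : bool :=
  [&& sorted geq mu, all (leq 1) mu & sumn mu == n].

(* The partition [p, n - p], sorted since either part may be the larger. *)
Definition two_parts (p n : nat) : seq nat := sort geq [:: p; (n - p)%N].

(* Number of cycles, fixed points included. *)
Definition kappa (n : nat) (s : 'S_n) : nat := #|porbits s|.

Definition cycle_type (n : nat) (s : 'S_n) : seq nat :=
  sort geq [seq #|C| | C : {set 'I_n} in porbits s].

(* The product of 'S_n composes left to right, (a * b) x = b (a x). With the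
   opposite convention gamma is replaced by a conjugate, so the map counts
   below do not depend on this choice. *)
Definition bicolored_map (n : nat) (a b c : 'S_n) : bool :=
  c == (a * b)%g.

Definition connected_map (n : nat) (a b c : 'S_n) : bool :=
  bicolored_map a b c
  && [transitive <<[set a; b]>>%g, on [set: 'I_n] | 'P].

Definition has_genus (g n : nat) (a b c : 'S_n) : bool :=
  (kappa a)%:Z + (kappa b)%:Z - n%:Z + (kappa c)%:Z == 2 - 2 * g%:Z.

(* bmaps p n mu g is B^g_{p,n}(mu). *)
Definition bmaps (p n : nat) (mu : seq nat) (g : nat) : nat :=
  #|[set t : 'S_n * 'S_n * 'S_n |
      let: (a, b, c) := t in
      [&& connected_map a b c, has_genus g a b c,
          cycle_type c == two_parts p n & cycle_type a == mu]]|.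

Definition log_concave (R : realDomainType) (s : nat -> R) : Prop :=
  forall i : nat, (0 < i)%N -> s i.-1 * s i.+1 <= s i ^+ 2.

Definition unimodal (R : realDomainType) (s : nat -> R) : Prop :=
  exists m : nat,
    (forall i : nat, (i < m)%N -> s i <= s i.+1) /\
    (forall i : nat, (m <= i)%N -> s i.+1 <= s i).

(* Main.v *)
Require Import Defs.
From HB Require Import structures.
From mathcomp Require Import all_boot all_order all_algebra all_fingroup.
From mathcomp Require Import all_field.
From mathcomp Require Import reals.
From mathcomp Require boolp.
From mathcomp Require Import mpoly zify ring lra.

(** Let d be the number of parts of mu and let P be the sum of X^k(b) over the
connected maps (a, b, c), c = a b, with a of type mu and c of type [p, n - p],
k(b) being the number of cycles of b.
As c has two cycles, the genus g maps are those with k(b) = n - d - 2g, so that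
the sequence of the theorem consists of the coefficients of P read from the top
in steps of two. It is therefore enough that all the roots of P are purely
imaginary: then P = X^e D(X^2) where D is a real multiple of a product of
factors X + t with t >= 0, and the coefficients of such a product are totally
positive of order two ([tp2_of_imaginary_roots]). This gives log-concavity and
also excludes internal zeros, whence unimodality.

To locate the roots, P is computed up to a positive factor. For a number N of
colours, n! P(N) is the sum over the pairs (a, c) of the given types, and over
the u that make (a^u, c) connected, of N^k(a^u c^-1). Let x_1, ..., x_N be
variables, Delta their Vandermonde product and p_r the power sums. Without the
connectivity condition the inner sum is the coefficient of the staircase
monomial in p_nu(d/dx) (p_mu(x) Delta(x)), where nu is the type of c
([csum_pairing]). Both sides are determined by the same recursion: adding a
point to c multiplies it by a transposition, which cuts or joins the cycles of
the other permutation, while a second order operator that kills Delta and is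
invisible at the staircase acts on the p_mu Delta by cutting and joining parts
([pairing_one], [pairing_insert]).

Power sums and their dual differential operators change one exponent at a time,
so that their commutators reduce to computations in one variable. With
nu = [p, n - p], moving the p_r(x) to the left, each r > p leaves only a
commutator, because everything else raises the degree too much to contribute to
the staircase coefficient. With q = n - p, S the shift f(X) -> f(X + 1) and
(X)_k the falling factorial, this gives ([pairing_large_parts])

  P ~ (1 + S + ... + S^(p-1)) [ (X)_p W(X - p) ],
  W = (S^mu_1 - 1) ... (S^mu_d - 1) (X)_q.

If all the parts of mu exceed p every map is connected. If mu = [p, q] the
computation leaves an extra term ([pairing_two_cycles]), which is exactly the
contribution of the maps that are not connected ([csum_matching]); so the same
formula holds in both cases ([connected_sum]).

The operators in the formula are products of factors S - w with |w| = 1. Such a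
factor moves a set of roots on a vertical line by 1/2 to the left, since
f(z + 1) = w f(z) forces z and z + 1 to be at equal distances from the line
([lstep_line]); and if f = (X)_k Q with the roots of Q on the line
Re z = (k - 1)/2, the image is of the same form with k - 1 in place of k
([lquot_line]). Applying all the factors brings the roots to Re z = 0
([connpoly_line]). *)

Set Implicit Arguments.
Unset Strict Implicit.
Unset Printing Implicit Defensive.

Import Order.TTheory GRing.Theory Num.Theory.
Local Open Scope ring_scope.

(** * Power sums and differential operators *)

Fixpoint picks {A : Type} (s : seq A) : seq (A * seq A) :=
  if s is x :: s' then (x, s') :: [seq (p.1, x :: p.2) | p <- picks s']
  else [::].

Lemma big_picks_cons (A : Type) (V : nmodType) (x : A) s (F : A * seq A -> V) :
  \sum_(p <- picks (x :: s)) F p =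
    F (x, s) + \sum_(p <- picks s) F (p.1, x :: p.2).
Proof. by rewrite /= big_cons big_map. Qed.

Lemma picks_perm (A : eqType) (s : seq A) p :
  p \in picks s -> perm_eq s (p.1 :: p.2).
Proof.
elim: s p => // x s IH p; rewrite inE => /orP[/eqP-> //|/mapP[p' /IH sp' ->]] /=.
apply: (@perm_trans _ (x :: p'.1 :: p'.2)); first by rewrite perm_cons.
by rewrite (permPl (permEl (perm_catCA [:: x] [:: p'.1] p'.2))).
Qed.

Section Operators.
Variable N : nat.
Local Notation P := {mpoly rat[N]}.
Implicit Types (f g h : P) (r b : nat) (rho nu : seq nat).

Definition psum r : P := \sum_(i < N) 'X_i ^+ r.
Definition psums rho : P := \prod_(r <- rho) psum r.

Definition vecf r g : P := \sum_(i < N) 'X_i ^+ r * g^`M(i).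

(** The second order operator of the recursion. The coefficient 1 - N of its first
order part gives the weight (k + 1)(k + 1 - N) to the step from x_i^(k+1) to
x_i^k ([coefs_lapl]), which vanishes for k + 1 = N: see [lapl_at_delta]. *)
Definition lapl g : P :=
  \sum_(i < N) 'X_i * g^`M(i)^`M(i) + (1 - N%:R) * vecf 0 g.

Definition dpow b g : P := \sum_(i < N) iter b (mderiv i) g.
Definition dpows nu g : P := foldr dpow g nu.

Lemma mderiv_sum (I : Type) (s : seq I) (Q : pred I) (F : I -> P) i :
  (\sum_(k <- s | Q k) F k)^`M(i) = \sum_(k <- s | Q k) (F k)^`M(i).
Proof. exact: (raddf_sum (mderiv i)). Qed.

Lemma mderiv_Xi i j : ('X_j : P)^`M(i) = (i == j)%:R.
Proof.
rewrite mderivX mnm1E eq_sym; case: eqP => [->|_]; last by rewrite scale0r.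
by rewrite scale1r -mpolyX0; congr ('X_[_]); apply/mnmP=> k; rewrite mnmBE mnm0E subnn.
Qed.

Lemma mderiv_Xn i j r : ('X_j ^+ r : P)^`M(i) = (i == j)%:R * (r%:R * 'X_i ^+ r.-1).
Proof.
elim: r => [|r IH].
  by rewrite expr0 -mpolyC1 mderivC mul0r mulr0.
rewrite exprS mderivM IH mderiv_Xi; case: eqP => [->|_]; last by rewrite !mul0r mulr0 addr0.
rewrite !mul1r /= -[r.+1]add1n natrD mulrDl mul1r; congr (_ + _).
case: r {IH} => [|r]; first by rewrite !mul0r mulr0.
by rewrite /= mulrCA -exprS.
Qed.

Lemma vecfM r f g : vecf r (f * g) = vecf r f * g + f * vecf r g.
Proof.
rewrite /vecf mulr_suml mulr_sumr -big_split /=; apply: eq_bigr => i _.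
by rewrite mderivM; ring.
Qed.

Lemma vecf_sum r (I : Type) (s : seq I) (Q : pred I) (F : I -> P) :
  vecf r (\sum_(k <- s | Q k) F k) = \sum_(k <- s | Q k) vecf r (F k).
Proof.
rewrite /vecf exchange_big /=; apply: eq_bigr => i _.
by rewrite mderiv_sum mulr_sumr.
Qed.

Lemma vecf1 r : vecf r 1 = 0.
Proof. by rewrite /vecf big1 // => i _; rewrite -mpolyC1 mderivC mulr0. Qed.

Lemma vecf_Xn r j s : vecf r ('X_j ^+ s) = s%:R * 'X_j ^+ (r + s.-1).
Proof.
rewrite /vecf (bigD1 j) //= mderiv_Xn eqxx mul1r big1 ?addr0; last first.
  by move=> i /negPf ij; rewrite mderiv_Xn ij mul0r mulr0.
by rewrite mulrCA -exprD.
Qed.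

Lemma vecf_prod r (I : Type) (s : seq I) (Q : pred I) (F c : I -> P) :
  (forall k, vecf r (F k) = c k * F k) ->
  vecf r (\prod_(k <- s | Q k) F k) =
    (\sum_(k <- s | Q k) c k) * \prod_(k <- s | Q k) F k.
Proof.
move=> Fc; elim: s => [|k s IH]; first by rewrite !big_nil vecf1 mul0r.
rewrite !big_cons; case: (Q k) => //.
by rewrite vecfM IH Fc; ring.
Qed.

Lemma vecf_psum r s : vecf r (psum s) = s%:R * psum (r + s.-1).
Proof.
rewrite /psum vecf_sum mulr_sumr; apply: eq_bigr => i _.
by rewrite vecf_Xn.
Qed.

Lemma vecf_psums r rho :
  vecf r (psums rho) =
    \sum_(p <- picks rho) p.1%:R * (psum (r + p.1.-1) * psums p.2).
Proof.
elim: rho => [|s rho IH]; first by rewrite /psums big_nil vecf1 big_nil.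
rewrite big_picks_cons /= {1}/psums big_cons vecfM vecf_psum IH mulrA.
congr (_ + _); rewrite mulr_sumr; apply: eq_bigr => p _.
by rewrite {2}/psums big_cons -/(psums _); ring.
Qed.

Definition van : P :=
  \prod_(i < N) \prod_(j < N | (i < j)%N) ('X_j - 'X_i).

(** The complete homogeneous symmetric polynomial of degree r - 1, for r > 0. *)
Definition hsum r (x y : P) : P := \sum_(l < r) x ^+ (r.-1 - l) * y ^+ l.

Lemma hsumC r x y : hsum r x y = hsum r y x.
Proof.
rewrite /hsum (reindex_inj rev_ord_inj) /=; apply: eq_bigr => l _.
have lr := ltn_ord l.
have -> : (r.-1 - (r - l.+1) = l)%N by lia.
have -> : (r - l.+1 = r.-1 - l)%N by lia.
by rewrite mulrC.
Qed.

Lemma hsum_diag r x : hsum r x x = r%:R * x ^+ r.-1.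
Proof.
rewrite /hsum (eq_bigr (fun=> x ^+ r.-1)); last first.
  by move=> l _; rewrite -exprD subnK //; have := ltn_ord l; lia.
by rewrite sumr_const card_ord mulr_natl.
Qed.

Lemma big_ord_pairs (V : nmodType) (F : 'I_N -> 'I_N -> V) :
  \sum_(i < N) \sum_(j < N) F i j =
    \sum_(i < N) F i i
    + \sum_(i < N) \sum_(j < N | (i < j)%N) (F i j + F j i).
Proof.
rewrite (eq_bigr (fun i => F i i + (\sum_(j < N | (i < j)%N) F i j
                         + \sum_(j < N | (j < i)%N) F i j))); last first.
  move=> i _; rewrite (bigD1 i) //=; congr (_ + _).
  rewrite (bigID (fun j : 'I_N => (i < j)%N)) /=.
  congr (_ + _).
    by apply: eq_bigl => j; rewrite -val_eqE /=; lia.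
  by apply: eq_bigl => j; rewrite -val_eqE /=; lia.
rewrite big_split /= big_split /= [X in _ + (_ + X)](exchange_big_dep xpredT) //=.
by congr (_ + _); rewrite -big_split /=; apply: eq_bigr => i _; rewrite -big_split.
Qed.

Lemma vecfB r f g : vecf r (f - g) = vecf r f - vecf r g.
Proof.
rewrite /vecf -sumrB; apply: eq_bigr => i _.
by rewrite mderivB mulrBr.
Qed.

(** The Vandermonde product is an eigenvector because each of its factors is one: the
vector field sends x_j - x_i to x_j^r - x_i^r. The eigenvalue is a sum over i < j
of complete homogeneous polynomials; doubling it and adding the diagonal gives a
sum over all the pairs (i, j), which is expressed by power sums. *)
Lemma vecf_van r :
  2%:R * vecf r van =
    (\sum_(l < r) psum (r.-1 - l) * psum l - r%:R * psum r.-1) * van.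
Proof.
have Dij (i j : 'I_N) : vecf r ('X_j - 'X_i) = hsum r 'X_j 'X_i * ('X_j - 'X_i).
  rewrite -['X_j in LHS]expr1 -['X_i in LHS]expr1 vecfB !vecf_Xn !mul1r !addn0.
  by rewrite subrXX mulrC.
rewrite /van (@vecf_prod _ _ _ _ _ (fun i : 'I_N => \sum_(j < N | (i < j)%N) hsum r 'X_j 'X_i));
  last by move=> i; exact: vecf_prod.
rewrite mulrA; congr (_ * _).
have -> : \sum_(l < r) psum (r.-1 - l) * psum l =
          \sum_(i < N) \sum_(j < N) hsum r 'X_i 'X_j :> P.
  rewrite /hsum (eq_bigr (fun i : 'I_N =>
     \sum_(l < r) \sum_(j < N) 'X_i ^+ (r.-1 - l) * 'X_j ^+ l)); last first.
    by move=> i _; rewrite exchange_big.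
  rewrite exchange_big /=; apply: eq_bigr => l _.
  by rewrite /psum mulr_suml; apply: eq_bigr => i _; rewrite mulr_sumr.
rewrite (big_ord_pairs (fun i j => hsum r 'X_i 'X_j)).
have -> : \sum_(i < N) hsum r 'X_i 'X_i = r%:R * psum r.-1 :> P.
  by rewrite mulr_sumr; apply: eq_bigr => i _; rewrite hsum_diag.
rewrite [_ + \sum_(i < N) _]addrC addrK mulr_sumr; apply: eq_bigr => i _.
rewrite mulr_sumr; apply: eq_bigr => j _.
by rewrite [hsum r 'X_i 'X_j]hsumC; ring.
Qed.

(** Second order Leibniz rule. Only the cross term differentiates both factors, and
it is a vector field acting on [g]. *)
Lemma laplM_psum r g : (0 < r)%N ->
  lapl (psum r * g) = psum r * lapl g + 2%:R * r%:R * vecf r g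
    + r%:R * (r%:R - N%:R) * psum r.-1 * g.
Proof.
move=> r0.
have V0 : vecf 0 (psum r * g) = r%:R * psum r.-1 * g + psum r * vecf 0 g.
  by rewrite vecfM vecf_psum.
rewrite /lapl V0.
have -> : \sum_(i < N) 'X_i * ((psum r * g)^`M(i))^`M(i) =
   psum r * (\sum_(i < N) 'X_i * (g^`M(i))^`M(i)) + 2%:R * r%:R * vecf r g
   + r%:R * (r%:R - 1) * psum r.-1 * g.
  rewrite /vecf !mulr_sumr mulr_suml -!big_split /=.
  apply: eq_bigr => i _.
  have dP : (psum r)^`M(i) = r%:R * 'X_i ^+ r.-1.
    rewrite /psum mderiv_sum (bigD1 i) //= mderiv_Xn eqxx mul1r big1 ?addr0 // => j.
    by rewrite eq_sym => /negPf ji; rewrite mderiv_Xn ji mul0r.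
  rewrite !mderivM dP !mderivD !mderivM dP.
  rewrite -[r%:R]mpolyC_nat mderivC mderiv_Xn eqxx mul0r add0r mul1r mpolyC_nat.
  case: r r0 {V0 dP} => // r _ /=.
  case: r => [|r]; first by rewrite !expr0 expr1; ring.
  by rewrite /= !exprS; ring.
ring.
Qed.

(** A part of size r loses one unit and is cut into l and r - 1 - l. The subtracted
term cancels the cut with l = 0, in which [psum 0] is N. *)
Definition split2 r : P := \sum_(l < r) psum (r.-1 - l) * psum l - N%:R * psum r.-1.

Definition cutjoin rho : P :=
  \sum_(p <- picks rho) p.1%:R * (split2 p.1 * psums p.2
     + \sum_(p' <- picks p.2) p'.1%:R * (psum (p.1 + p'.1).-1 * psums p'.2)).

Lemma psums_cons r rho : psums (r :: rho) = psum r * psums rho.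
Proof. by rewrite /psums big_cons. Qed.

(** Pulling the power sums out of the operator one at a time, the cross terms act on
the remaining power sums, which joins two parts, and on the Vandermonde product,
which cuts a part by [vecf_van]. *)
Lemma lapl_psums_van rho : lapl van = 0 -> all (leq 1) rho ->
  lapl (psums rho * van) = cutjoin rho * van.
Proof.
move=> van0; elim: rho => [_|r rho IH /= /andP[r0 rho0]].
  by rewrite /psums /cutjoin !big_nil mul1r mul0r.
rewrite psums_cons -mulrA laplM_psum // (IH rho0) vecfM mulrDr.
have -> : 2%:R * r%:R * (psums rho * vecf r van) =
          r%:R * psums rho * (2%:R * vecf r van) by ring.
rewrite vecf_van vecf_psums /cutjoin big_picks_cons /=.
rewrite [X in _ = (_ + X) * _](eq_big_seq (fun p =>
  psum r * (p.1%:R * (split2 p.1 * psums p.2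
     + \sum_(p' <- picks p.2) p'.1%:R * (psum (p.1 + p'.1).-1 * psums p'.2)))
  + r%:R * (p.1%:R * (psum (r + p.1.-1) * psums p.2)))); last first.
  move=> p /picks_perm/perm_all prho; rewrite prho /= in rho0.
  have /andP[p0 _] := rho0.
  rewrite big_cons big_map /= psums_cons !mulrDr -!addrA; congr (_ + _); first by ring.
  rewrite addrC; congr (_ + _).
    have -> : (r + p.1.-1 = (p.1 + r).-1)%N by rewrite -[in RHS](prednK p0) addSn addnC.
    ring.
  by rewrite !mulr_sumr; apply: eq_bigr => p' _; rewrite psums_cons; ring.
rewrite big_split /= -!mulr_sumr.
have -> : \sum_(p <- picks rho) p.1%:R * (psum (r + p.1).-1 * psums p.2) =
          \sum_(p <- picks rho) p.1%:R * (psum (r + p.1.-1) * psums p.2).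
  apply: eq_big_seq => p /picks_perm/perm_all prho; rewrite prho /= in rho0.
  have /andP[p0 _] := rho0.
  have -> // : ((r + p.1).-1 = r + p.1.-1)%N by rewrite -{1}(prednK p0) addnS.
rewrite /split2; ring.
Qed.

(** * Operators that change one exponent *)

Definition upd (m : 'X_{1..N}) i y : 'X_{1..N} :=
  [multinom if k == i then y else m k | k < N].

(** Multiplication by a power sum and the operators [dpow] and [lapl] change one
exponent of a monomial at a time. On coefficient functions they take
the following form, where the coefficient at [m] is read off from those where the
exponent [m i] is replaced by [y (m i)]. *)
Definition onebody (y : nat -> nat) (w : nat -> rat) (phi : 'X_{1..N} -> rat)
    (m : 'X_{1..N}) : rat :=
  \sum_(i < N) w (m i) * phi (upd m i (y (m i))).

Definition coefs g (m : 'X_{1..N}) : rat := g@_m.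

Lemma mcoeff_XnM i r g (m : 'X_{1..N}) :
  ('X_i ^+ r * g)@_m = if (r <= m i)%N then g@_(upd m i (m i - r)) else 0.
Proof.
rewrite mpolyXn mulrC; case: leqP => mr.
  have E : (upd m i (m i - r) + U_(i) *+ r)%MM = m.
    apply/mnmP => k; rewrite mnmDE mulmnE mnmE mnm1E eq_sym.
    by case: eqP => [<-|_]; rewrite ?mul1n ?mul0n ?addn0 ?subnK.
  by rewrite -{1}E addmC mcoeffMX.
apply: memN_msupp_eq0; rewrite (perm_mem (msuppMX _ _)).
apply/negP => /mapP[m' _ mE].
move: mr; rewrite mE mnmDE mulmnE mnm1E eqxx mul1n; lia.
Qed.

Lemma coefs_psumM r g :
  coefs (psum r * g) = onebody (fun x => x - r)%N (fun x => (r <= x)%N%:R) (coefs g).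
Proof.
apply: boolp.funext => m; rewrite /coefs mulr_suml raddf_sum; apply: eq_bigr => i _.
by rewrite /= mcoeff_XnM; case: leqP => _; rewrite ?mul1r ?mul0r.
Qed.

Lemma upd_add (m : 'X_{1..N}) i b : (m + U_(i) *+ b)%MM = upd m i (m i + b).
Proof.
apply/mnmP => k; rewrite mnmDE mulmnE mnm1E mnmE eq_sym.
by case: eqP => [->|_]; rewrite ?mul1n ?mul0n ?addn0.
Qed.

Lemma mcoeff_iter_mderiv i b g m :
  (iter b (mderiv i) g)@_m = ((m i + b) ^_ b)%:R * g@_(upd m i (m i + b)).
Proof.
rewrite -upd_add; elim: b m => [|b IH] m.
  by rewrite ffactn0 mul1r mulm0n addm0.
rewrite iterS mcoeff_deriv IH mnmDE mnm1E eqxx -addmA -mulmS.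
rewrite -[_ *+ (m i).+1]mulr_natr mulrAC -natrM; congr (_%:R * _).
by rewrite -[(m i + b.+1)%N]addSnnS addn1 addnC ffactnSr; congr (_ * _)%N; lia.
Qed.

Lemma coefs_dpow b g :
  coefs (dpow b g) = onebody (fun x => x + b)%N (fun x => ((x + b) ^_ b)%:R) (coefs g).
Proof.
apply: boolp.funext => m; rewrite /coefs raddf_sum; apply: eq_bigr => i _.
by rewrite /= mcoeff_iter_mderiv.
Qed.

Lemma coefs_lapl g :
  coefs (lapl g) = onebody succn (fun x => x.+1%:R * (x.+1%:R - N%:R)) (coefs g).
Proof.
apply: boolp.funext => m; rewrite /coefs.
have d1 h i m' : (h^`M(i))@_m' = (m' i).+1%:R * h@_(upd m' i (m' i).+1).
  by rewrite -[h^`M(i)]/(iter 1 (mderiv i) h) mcoeff_iter_mderiv addn1 ffactn1.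
rewrite /lapl mulrBl mul1r mulr_natl mcoeffD mcoeffB mcoeffMn /vecf !raddf_sum /=.
rewrite -sumrMnl -sumrB -big_split /=; apply: eq_bigr => i _.
rewrite mul1r d1 -{1}['X_i]expr1 mcoeff_XnM.
have -> : (if (0 < m i)%N then (g^`M(i))^`M(i)@_(upd m i (m i - 1)) else 0) =
          (m i)%:R * (m i).+1%:R * g@_(upd m i (m i).+1).
  case: posnP => [->|m0]; first by rewrite !mul0r.
  rewrite !d1 !mnmE eqxx subn1 (prednK m0) mulrA; congr (_ * _@_ _).
  by apply/mnmP => k; rewrite !mnmE; case: eqP.
rewrite -[_ *+ N]mulr_natr -[(m i).+1]addn1 natrD; ring.
Qed.

Lemma upd_same (m : 'X_{1..N}) i y y' : upd (upd m i y) i y' = upd m i y'.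
Proof. by apply/mnmP => k; rewrite !mnmE; case: eqP. Qed.

Lemma upd_id (m : 'X_{1..N}) i : upd m i (m i) = m.
Proof. by apply/mnmP => k; rewrite !mnmE; case: eqP => // ->. Qed.

Lemma upd_comm (m : 'X_{1..N}) i j y z : i != j -> upd (upd m i y) j z = upd (upd m j z) i y.
Proof.
move=> /eqP ij; apply/mnmP => k; rewrite !mnmE.
by case: eqP => [->|_] //; case: eqP => // jk; case: ij.
Qed.

Lemma onebody_comp y w y' w' phi m :
  onebody y w (onebody y' w' phi) m =
    \sum_(i < N) (w (m i) * w' (y (m i))) * phi (upd m i (y' (y (m i))))
    + \sum_(i < N) \sum_(j < N | (i < j)%N)
        (w (m i) * w' (m j) * phi (upd (upd m i (y (m i))) j (y' (m j)))
        + w (m j) * w' (m i) * phi (upd (upd m j (y (m j))) i (y' (m i)))).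
Proof.
rewrite /onebody.
under eq_bigr => i _ do rewrite mulr_sumr.
rewrite big_ord_pairs; congr (_ + _).
  by apply: eq_bigr => i _; rewrite !mnmE eqxx upd_same mulrA.
apply: eq_bigr => i _; apply: eq_bigr => j ij.
have ne : j == i = false by apply/negP => /eqP ji; rewrite ji ltnn in ij.
by rewrite !mnmE ne eq_sym ne !mulrA.
Qed.

(** Moves at two distinct positions commute, so that only the pairs of moves at the
same position survive: commutators of such operators are computed in one
variable. *)
Lemma onebody_commutator y w y' w' phi m :
  onebody y w (onebody y' w' phi) m - onebody y' w' (onebody y w phi) m =
    \sum_(i < N) ((w (m i) * w' (y (m i))) * phi (upd m i (y' (y (m i))))
                 - (w' (m i) * w (y' (m i))) * phi (upd m i (y (y' (m i))))).
Proof.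
rewrite !onebody_comp sumrB opprD addrACA -[RHS]addr0; congr (_ + _).
apply/eqP; rewrite subr_eq0; apply/eqP; apply: eq_bigr => i _.
apply: eq_bigr => j ij.
have ne : i != j by apply/negP => /eqP ji; rewrite ji ltnn in ij.
rewrite addrC; congr (_ + _).
  by rewrite upd_comm 1?eq_sym // [w _ * _]mulrC.
by rewrite upd_comm // [w _ * _]mulrC.
Qed.

Definition swp (i j : 'I_N) (m : 'X_{1..N}) : 'X_{1..N} :=
  [multinom m (tperm i j k) | k < N].

(** The coefficient functions of antisymmetric polynomials. *)
Definition alternating (phi : 'X_{1..N} -> rat) : Prop :=
  forall i j m, i != j -> phi (swp i j m) = - phi m.

Lemma alternating_repeat phi i j (m : 'X_{1..N}) :
  alternating phi -> i != j -> m i = m j -> phi m = 0.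
Proof.
move=> alt ij mij; have := alt _ _ m ij.
have -> : swp i j m = m.
  by apply/mnmP => k; rewrite mnmE; case: tpermP => [->|->|].
lra.
Qed.

Lemma alternating_onebody y w phi : alternating phi -> alternating (onebody y w phi).
Proof.
move=> alt i j m ij; rewrite /onebody (reindex_inj (@perm_inj _ (tperm i j))) /=.
rewrite -sumrN; apply: eq_bigr => k _.
rewrite mnmE tpermK -mulrN -(alt i j) //; congr (_ * phi _).
apply/mnmP => l; rewrite !mnmE -(inj_eq (@perm_inj _ (tperm i j))) tpermK.
by case: eqP => // _; rewrite mnmE.
Qed.

(** * The staircase coefficient *)

(** The staircase exponent, whose permutations index the monomials of [van]. *)
Definition delta : 'X_{1..N} := [multinom (i : nat) | i < N].

Definition mperm (s : 'S_N) : 'X_{1..N} := [multinom (s i : nat) | i < N].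

Lemma vanE : van = \sum_(s : 'S_N) (-1) ^+ s *: 'X_[mperm s].
Proof.
have -> : van = \det (Vandermonde N (\row_j ('X_j : P))).
  rewrite det_Vandermonde; apply: eq_bigr => i _; apply: eq_bigr => j _.
  by rewrite !mxE.
rewrite /determinant (reindex_inj invg_inj) /=; apply: eq_bigr => s _.
rewrite odd_permV mpolyXE_id scaler_sign mulr_sign.
have -> : \prod_(i < N) (Vandermonde N (\row_j ('X_j : P))) i ((s^-1)%g i) =
          \prod_(i < N) 'X_i ^+ (mperm s i).
  rewrite (reindex_inj (@perm_inj _ s)) /=; apply: eq_bigr => i _.
  by rewrite !mxE permK mnmE.
by [].
Qed.

Lemma coefs_van m : coefs van m = \sum_(s : 'S_N) (-1) ^+ s * (mperm s == m)%:R.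
Proof.
rewrite /coefs vanE raddf_sum; apply: eq_bigr => s _.
by rewrite /= mcoeffZ mcoeffX.
Qed.

Lemma coefs_van_neq0 m : coefs van m != 0 -> exists s, m = mperm s.
Proof.
rewrite coefs_van => /eqP m0; case: (pickP (fun s => mperm s == m)) => [s /eqP <-|no].
  by exists s.
by case: m0; rewrite big1 // => s _; rewrite no mulr0.
Qed.

Lemma alternating_van : alternating (coefs van).
Proof.
move=> i j m ij; rewrite !coefs_van (reindex_inj (mulgI (tperm i j))) /= -sumrN.
apply: eq_bigr => s _; rewrite odd_permM odd_tperm ij signr_addb mulN1r mulNr.
congr (- (_ * (nat_of_bool _)%:R)); apply/eqP/eqP => [/mnmP E|<-].
  by apply/mnmP => k; have := E (tperm i j k); rewrite !mnmE permM !tpermK.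
by apply/mnmP => k; rewrite !mnmE permM.
Qed.

Lemma mperm_delta s : (mperm s == delta) = (s == 1%g).
Proof.
apply/eqP/eqP => [/mnmP E|->].
  by apply/permP => k; apply/val_inj; have := E k; rewrite !mnmE perm1.
by apply/mnmP => k; rewrite !mnmE perm1.
Qed.

Lemma coefs_van_delta : coefs van delta = 1.
Proof.
rewrite coefs_van (bigD1 1%g) //= big1 => [|s /negPf s1]; last first.
  by rewrite mperm_delta s1 mulr0.
by rewrite mperm_delta eqxx odd_perm1 addr0 mulr1.
Qed.

(** A monomial of the image comes from a permutation of the staircase with one of its
exponents lowered by one. The lowered exponent already occurs at another
position, and an alternating function vanishes at repeated exponents. *)
Lemma lowering_van w m : onebody succn w (coefs van) m = 0.
Proof.
case: (pickP (fun i => coefs van (upd m i (m i).+1) != 0)) => [i|no]; last first.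
  by rewrite /onebody big1 // => i _; move/negbFE/eqP: (no i) => ->; rewrite mulr0.
move=> /coefs_van_neq0[s /mnmP mE].
have si : s i = (m i).+1 :> nat by have := mE i; rewrite !mnmE eqxx => ->.
have miN : (m i < N)%N by rewrite ltnW // -si.
pose j := (s^-1)%g (Ordinal miN).
have sj : s j = m i :> nat by rewrite permKV.
have ji : i != j by apply/eqP => E; move: sj; rewrite -E si; lia.
have mj : m j = m i.
  by have := mE j; rewrite !mnmE eq_sym (negPf ji) sj.
exact: (alternating_repeat (alternating_onebody _ _ alternating_van) ji).
Qed.

Lemma coefs_inj f g : coefs f = coefs g -> f = g.
Proof. by move=> E; apply/mpolyP => m; rewrite -/(coefs f m) E. Qed.

Lemma coefsD f g m : coefs (f + g) m = coefs f m + coefs g m.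
Proof. exact: mcoeffD. Qed.

Lemma coefsMn f k m : coefs (f *+ k) m = coefs f m *+ k.
Proof. exact: mcoeffMn. Qed.

Lemma lapl_van : lapl van = 0.
Proof.
by apply: coefs_inj; apply: boolp.funext => m; rewrite coefs_lapl lowering_van /coefs mcoeff0.
Qed.

Lemma vecf0_dpow g : vecf 0 g = dpow 1 g.
Proof. by apply: eq_bigr => i _; rewrite mul1r. Qed.

Lemma vecf0_van : vecf 0 van = 0.
Proof.
apply: coefs_inj; apply: boolp.funext => m; rewrite vecf0_dpow coefs_dpow /coefs mcoeff0.
rewrite -(lowering_van (fun x => ((x + 1) ^_ 1)%:R) m).
by apply: eq_bigr => i _; rewrite addn1.
Qed.

(** Raising an exponent of the staircase produces a repeated exponent, except for the
top one N - 1, where the weight of the operator is zero. *)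
Lemma lapl_at_delta h : alternating (coefs h) -> coefs (lapl h) delta = 0.
Proof.
move=> alt; rewrite coefs_lapl /onebody big1 // => i _.
rewrite mnmE; have [iN|iN] := ltnP i.+1 N; last first.
  have -> : i.+1 = N by apply/eqP; rewrite eqn_leq iN ltn_ord.
  by rewrite subrr mulr0 mul0r.
rewrite (alternating_repeat (i := i) (j := Ordinal iN) alt) ?mulr0 //.
  by rewrite -val_eqE /= neq_ltn ltnSn.
by rewrite !mnmE eqxx -val_eqE /= gtn_eqF.
Qed.

(** By [onebody_commutator] this reduces to an identity between falling factorials in
one variable. *)
Lemma dpow_lapl b g : dpow b (lapl g) = lapl (dpow b g) + dpow b.+1 g *+ b.
Proof.
apply: coefs_inj; apply: boolp.funext => m.
rewrite coefsD coefsMn; apply/eqP; rewrite addrC -subr_eq; apply/eqP.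
rewrite !(coefs_dpow, coefs_lapl) onebody_commutator -sumrMnl.
apply: eq_bigr => i _; rewrite [((m i).+1 + b)%N]addSn -addnS -mulrBl -mulrnAl.
congr (_ * _); move: (m i) => x.
have e1 : ((x + b.+1) ^_ b.+1)%:R = ((x + b) ^_ b)%:R * (x + b.+1)%:R :> rat.
  by rewrite addnS ffactSS mulnC natrM.
have e2 : ((x + b.+1) ^_ b.+1)%:R = x.+1%:R * ((x + b.+1) ^_ b)%:R :> rat.
  rewrite ffactnSr mulnC natrM; congr (_%:R * _); lia.
have hy : (x + b.+1)%:R = x.+1%:R + b%:R :> rat by rewrite addnS -addSn natrD.
rewrite -[_ *+ b]mulr_natr mulrA -e1 mulrAC -e2 hy; ring.
Qed.

Lemma dpowC b c g : dpow b (dpow c g) = dpow c (dpow b g).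
Proof.
apply: coefs_inj; apply: boolp.funext => m; apply/eqP; rewrite -subr_eq0.
rewrite !coefs_dpow onebody_commutator big1 // => i _; apply/eqP.
rewrite subr_eq0 -!addnA [(b + c)%N]addnC; apply/eqP; congr (_ * _).
move: (m i) => x; rewrite -!natrM; congr (_%:R).
have E d e : ((x + d) ^_ d * (x + (d + e)) ^_ e = (x + (d + e)) ^_ (e + d))%N.
  elim: e => [|e IH]; first by rewrite ffactn0 muln1 addn0.
  by rewrite !addnS addSn !ffactSS mulnCA IH.
by rewrite [in RHS]E [in LHS](addnC c b) E (addnC c b).
Qed.

Lemma iter_mderiv_linear b i : linear (iter b (mderiv i) : P -> P).
Proof.
move=> c f g; elim: b => // b IH.
by rewrite !iterS IH mderivD mderivZ.
Qed.

Lemma dpows_linear nu : linear (dpows nu).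
Proof.
elim: nu => // b nu IH c f g; rewrite /= /dpow IH.
rewrite scaler_sumr -big_split /=; apply: eq_bigr => i _.
exact: iter_mderiv_linear.
Qed.

HB.instance Definition _ nu :=
  GRing.isLinear.Build rat P P *:%R (dpows nu) (@dpows_linear nu).

Lemma dpows_dpow nu b g : dpows nu (dpow b g) = dpow b (dpows nu g).
Proof. by elim: nu => //= c nu ->; rewrite dpowC. Qed.

Lemma dpows_perm nu nu' g : perm_eq nu nu' -> dpows nu g = dpows nu' g.
Proof.
elim: nu nu' => [|b nu IH] nu' nn'.
  by move: nn'; rewrite perm_sym => /perm_nilP ->.
have /rot_to[i s' rE] : b \in nu' by rewrite -(perm_mem nn') mem_head.
have rn : perm_eq nu' (b :: s') by rewrite -rE perm_sym perm_rot.
have -> : dpows nu' g = dpows (b :: s') g.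
  rewrite -rE /rot; move: (cat_take_drop i nu') => {1}<-.
  rewrite /dpows !foldr_cat -!/(dpows _ _).
  elim: (take i nu') => // c s IHs; rewrite /= IHs.
  by elim: (drop i nu') => //= d s'' IHd; rewrite dpowC IHd.
rewrite /=; congr (dpow b _); apply: IH.
by rewrite -(perm_cons b) (perm_trans nn').
Qed.

Lemma dpows_lapl nu g :
  dpows nu (lapl g) =
    lapl (dpows nu g) + \sum_(p <- picks nu) dpows (p.1.+1 :: p.2) g *+ p.1.
Proof.
elim: nu => [|b nu IH]; first by rewrite /= big_nil addr0.
rewrite big_picks_cons /= IH.
have dpowD f h : dpow b (f + h) = dpow b f + dpow b h := raddfD (dpows [:: b]) f h.
have dpow_sum (s : seq (nat * seq nat)) F :
    dpow b (\sum_(p <- s) F p) = \sum_(p <- s) dpow b (F p) :=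
  raddf_sum (dpows [:: b]) _ _ _.
rewrite dpowD dpow_lapl -addrA; congr (_ + (_ + _)); rewrite dpow_sum.
apply: eq_bigr => p _; rewrite -[dpow b _]/(dpows [:: b] _) raddfMn /=.
by rewrite dpowC.
Qed.

Lemma alternating_dpows nu g : alternating (coefs g) -> alternating (coefs (dpows nu g)).
Proof.
move=> alt; elim: nu => //= b nu IH; rewrite coefs_dpow.
exact: alternating_onebody.
Qed.

Lemma alternating_psums rho g : alternating (coefs g) -> alternating (coefs (psums rho * g)).
Proof.
move=> alt; elim: rho => [|b nu IH]; first by rewrite /psums big_nil mul1r.
rewrite psums_cons -mulrA coefs_psumM; exact: alternating_onebody.
Qed.

(** This coefficient takes the place of a sum over irreducible characters: up to a
power of N it is the sum of N^k(s^u c^-1) over u, where k is the number of cycles and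
c and s have the cycle types [nu] and [rho], see [csum_pairing]. *)
Definition pairing nu rho : rat := coefs (dpows nu (psums rho * van)) delta.

Lemma psum0 : psum 0 = N%:R.
Proof. by rewrite /psum (eq_bigr (fun=> 1)) // sumr_const card_ord. Qed.

Lemma pairing_perm nu nu' rho rho' :
  perm_eq nu nu' -> perm_eq rho rho' -> pairing nu rho = pairing nu' rho'.
Proof.
move=> nn' rr'; rewrite /pairing (dpows_perm _ nn'); congr (coefs (dpows _ (_ * _)) _).
exact: perm_big.
Qed.

Lemma pairing_nil : pairing [::] [::] = 1.
Proof. by rewrite /pairing /= /psums big_nil mul1r coefs_van_delta. Qed.

Lemma pairing_zero nu rho : pairing nu (0%N :: rho) = N%:R * pairing nu rho.
Proof.
rewrite /pairing psums_cons psum0 -mulrA mulr_natl raddfMn /= coefsMn.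
by rewrite mulr_natl.
Qed.

Definition evalat nu g : rat := coefs (dpows nu g) delta.

Lemma evalat_linear nu : linear (evalat nu : P -> rat^o).
Proof.
move=> c f g; rewrite /evalat linearP /= coefsD; congr (_ + _).
exact: mcoeffZ.
Qed.

HB.instance Definition _ nu :=
  GRing.isLinear.Build rat P rat^o *:%R (evalat nu) (@evalat_linear nu).

Lemma evalat_nat nu k g : evalat nu (k%:R * g) = k%:R * evalat nu g.
Proof. by rewrite mulr_natl raddfMn /= mulr_natl. Qed.

Lemma pairingE nu rho : pairing nu rho = evalat nu (psums rho * van).
Proof. by []. Qed.

(** The operator p_1(d/dx) is a derivation that kills the Vandermonde product, hence it
only acts on the power sums. *)
Lemma pairing_one nu rho :
  pairing (1%N :: nu) rho =
    \sum_(p <- picks rho) p.1%:R * pairing nu (p.1.-1 :: p.2).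
Proof.
rewrite {1}/pairing [dpows (1%N :: nu) _]/= -dpows_dpow -vecf0_dpow vecfM vecf0_van.
rewrite mulr0 addr0 vecf_psums mulr_suml -/(evalat nu _) raddf_sum /=.
apply: eq_bigr => p _; rewrite -!mulrA evalat_nat add0n.
by rewrite pairingE psums_cons mulrA.
Qed.

(** The staircase coefficient of p_nu(d/dx) lapl (p_rho van) is computed in two ways.
Moving [lapl] to the left, it disappears by [lapl_at_delta] and its commutators
lengthen one part of [nu]; on the right it cuts and joins the parts of [rho]. *)
Lemma pairing_insert nu rho : all (leq 1) rho ->
  \sum_(p <- picks nu) p.1%:R * pairing (p.1.+1 :: p.2) rho =
  \sum_(p <- picks rho) p.1%:R *
    (\sum_(l < p.1) pairing nu [:: (p.1.-1 - l)%N, l : nat & p.2]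
     - N%:R * pairing nu (p.1.-1 :: p.2)
     + \sum_(p' <- picks p.2) p'.1%:R * pairing nu ((p.1 + p'.1).-1 :: p'.2)).
Proof.
move=> rho0.
have alt : alternating (coefs (dpows nu (psums rho * van))).
  by apply: alternating_dpows; apply: alternating_psums; exact: alternating_van.
have := congr1 (fun h => coefs h delta) (dpows_lapl nu (psums rho * van)).
rewrite /= coefsD (lapl_at_delta alt) add0r lapl_psums_van ?lapl_van //.
have coefs_sum (s : seq (nat * seq nat)) F :
   coefs (\sum_(p <- s) F p) delta = \sum_(p <- s) coefs (F p) delta.
  exact: raddf_sum.
rewrite coefs_sum => E; transitivity (evalat nu (cutjoin rho * van)).
  by rewrite /evalat E; apply: eq_bigr => p _; rewrite coefsMn mulr_natl.
rewrite /cutjoin mulr_suml raddf_sum /=; apply: eq_bigr => p _.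
rewrite -!mulrA evalat_nat; congr (_ * _).
rewrite mulrDl raddfD /= /split2 mulrBl mulrBl raddfB /=.
congr (_ - _ + _).
- rewrite !mulr_suml raddf_sum; apply: eq_bigr => l _.
  by rewrite pairingE !psums_cons -!mulrA.
- by rewrite -!mulrA evalat_nat pairingE psums_cons -!mulrA.
rewrite !mulr_suml raddf_sum /=; apply: eq_bigr => p' _.
by rewrite -!mulrA evalat_nat pairingE psums_cons -!mulrA.
Qed.

End Operators.

(** * Evaluation of the pairing *)

Definition ffpoly (k : nat) : {poly rat} := \prod_(i < k) ('X - i%:R%:P).

Lemma ffpolyE k n : (ffpoly k).[n%:R] = (n ^_ k)%:R.
Proof.
elim: k => [|k IH]; first by rewrite /ffpoly big_ord0 hornerE ffactn0.
rewrite /ffpoly big_ord_recr hornerM IH !hornerE ffactnSr natrM.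
have [kn|nk] := leqP k n; first by rewrite natrB.
by rewrite ffact_small // !mul0r.
Qed.

Definition sdiff (r : nat) (W : {poly rat}) : {poly rat} := W \Po ('X + r%:R%:P) - W.

Lemma sdiffE r W x : (sdiff r W).[x] = W.[x + r%:R] - W.[x].
Proof. by rewrite /sdiff !hornerE horner_comp !hornerE. Qed.

Definition sdiffs (mu : seq nat) (W : {poly rat}) := foldl (fun W r => sdiff r W) W mu.

(** With S the shift, this is (1 + S + ... + S^(a-1)) applied to (X)_a W(X - a),
where W is the product of the S^r - 1 over the parts r of [mu], applied to
(X)_b. The proof of [connpoly_line] relies on that factorised form. *)
Definition connpoly (a b : nat) (mu : seq nat) : {poly rat} :=
  \sum_(j < a) (sdiffs mu (ffpoly b) \Po ('X - a%:R%:P + j%:R%:P))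
             * (ffpoly a \Po ('X + j%:R%:P)).

Section Evaluation.
Variable N : nat.
Local Notation V := ('X_{1..N} -> rat).
Implicit Types (phi : V) (W : {poly rat}).

Definition pmul r phi : V := onebody (fun x => x - r)%N (fun x => (r <= x)%N%:R) phi.

(** The operator x^k -> W(k) x^(k + t - b), applied to one variable at a time. For
t = 0 and W = (X)_b it is p_b(d/dx), and commutators with the multiplication by
p_r keep the form, with t + r in place of t ([wop_pmul]). *)
Definition wop W b t phi : V :=
  onebody (fun x => x + b - t)%N
          (fun x => if (t <= x + b)%N then W.[(x + b - t)%:R] else 0) phi.

Lemma coefs_dpow_wop b g : coefs (dpow b g) = wop (ffpoly b) b 0 (coefs g) :> V.
Proof.
rewrite coefs_dpow; apply: boolp.funext => m; apply: eq_bigr => i _.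
by rewrite /= subn0 ffpolyE.
Qed.

(** The operator [wop W b t] would send x^y to a negative power of x when y + t < b,
so such monomials have to be killed by W. *)
Definition vanishing W b t := forall y, (y + t < b)%N -> W.[y%:R] = 0.

Lemma vanishing_ffpoly b : vanishing (ffpoly b) b 0.
Proof. by move=> y yb; rewrite ffpolyE ffact_small //; lia. Qed.

Lemma vanishing_sdiff r W b t : vanishing W b t -> vanishing (sdiff r W) b (t + r).
Proof.
by move=> Wv y yb; rewrite sdiffE -natrD !Wv ?subr0 //; lia.
Qed.

Lemma wop_pmul W b t r phi m : vanishing W b t ->
  wop W b t (pmul r phi) m =
    pmul r (wop W b t phi) m + wop (sdiff r W) b (t + r) phi m.
Proof.
move=> Wv; apply/eqP; rewrite addrC -subr_eq; apply/eqP.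
rewrite /wop /pmul onebody_commutator; apply: eq_bigr => i _.
move: (m i) => x.
have e1 : (x + b - t - r = x + b - (t + r))%N by lia.
case: (leqP (t + r) (x + b)) => tr; last first.
  have -> : (if (t <= x + b)%N then W.[(x + b - t)%:R] else 0) * (r <= x + b - t)%N%:R = 0.
    by case: leqP => // ?; rewrite ?mul0r //; case: leqP => //; rewrite ?mulr0 //; lia.
  rewrite !mul0r sub0r; case: leqP => rx; last by rewrite !mul0r oppr0.
  by rewrite ifF ?mulr0 ?mul0r ?oppr0 //; lia.
rewrite ifT; last by lia.
have -> : (r <= x + b - t)%N by lia.
rewrite mulr1 e1 sdiffE mulrBl -natrD.
have -> : (x + b - (t + r) + r = x + b - t)%N by lia.
congr (_ - _); case: leqP => rx.
  rewrite mul1r ifT; last by lia.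
  by have -> : (x - r + b - t = x + b - (t + r))%N by lia.
rewrite !mul0r Wv ?mul0r //; lia.
Qed.

(** If every move reads from a strictly smaller exponent, then at the staircase it
reads at an exponent that also occurs at another position. *)
Lemma raising_at_delta y w phi : alternating phi ->
  (forall x, w x != 0 -> (y x < x)%N) -> onebody y w phi (delta N) = 0.
Proof.
move=> alt up; rewrite /onebody big1 // => i _; rewrite mnmE.
have [->|wi] := eqVneq (w i) 0; first by rewrite mul0r.
have yi := up _ wi; have yN : (y i < N)%N by apply: ltn_trans yi _.
rewrite (alternating_repeat (i := i) (j := Ordinal yN) alt) ?mulr0 //.
  by rewrite -val_eqE /= gtn_eqF.
by rewrite !mnmE eqxx -val_eqE /= ltn_eqF.
Qed.

Lemma pmul_at_delta r phi : alternating phi -> (0 < r)%N -> pmul r phi (delta N) = 0.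
Proof.
move=> alt r0; apply: raising_at_delta => // x.
by rewrite /=; case: (leqP r x) => [rx _|_]; [lia | rewrite eqxx].
Qed.

Lemma wop_at_delta W b t phi :
  alternating phi -> (b < t)%N -> wop W b t phi (delta N) = 0.
Proof.
move=> alt bt; apply: raising_at_delta => // x.
by rewrite /=; case: (leqP t (x + b)) => [tx _|_]; [lia | rewrite eqxx].
Qed.

Lemma alternating_wop W b t phi : alternating phi -> alternating (wop W b t phi).
Proof. exact: alternating_onebody. Qed.

Definition evd a phi : rat := wop (ffpoly a) a 0 phi (delta N).

(** Moved to the left of p_a(d/dx), the multiplication by p_r and its commutator both
raise degrees, because r > a. *)
Lemma evd_pmul a r phi : alternating phi -> (a < r)%N -> evd a (pmul r phi) = 0.
Proof.
move=> alt ar; rewrite /evd wop_pmul; last exact: vanishing_ffpoly.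
rewrite pmul_at_delta ?wop_at_delta ?addr0 //; last by lia.
exact: alternating_wop.
Qed.

Lemma onebodyD y w phi psi (m : 'X_{1..N}) :
  onebody y w (fun m => phi m + psi m) m = onebody y w phi m + onebody y w psi m.
Proof. by rewrite /onebody -big_split /=; apply: eq_bigr => i _; rewrite mulrDr. Qed.

Lemma onebodyZ y w c phi (m : 'X_{1..N}) :
  onebody y w (fun m => c * phi m) m = c * onebody y w phi m.
Proof. by rewrite /onebody mulr_sumr; apply: eq_bigr => i _; rewrite mulrCA. Qed.

Lemma wop_pmul_fun W b t r phi : vanishing W b t ->
  wop W b t (pmul r phi) =
    (fun m => pmul r (wop W b t phi) m + wop (sdiff r W) b (t + r) phi m).
Proof. by move=> Wv; apply: boolp.funext => m; exact: wop_pmul. Qed.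

Lemma coefs_psumsM_alt rho : alternating (coefs (psums N rho * van N)).
Proof. by apply: alternating_psums; exact: alternating_van. Qed.

Lemma coefs_psums_cons r rho g :
  coefs (psums N (r :: rho) * g) = pmul r (coefs (psums N rho * g)).
Proof. by rewrite psums_cons -mulrA coefs_psumM. Qed.

(** The multiplications by power sums are moved to the left one at a time. Since each
part exceeds [a], only the commutators contribute, by [evd_pmul]. *)
Lemma evd_wop_psums a b t W mu : vanishing W b t -> all (leq a.+1) mu ->
  evd a (wop W b t (coefs (psums N mu * van N))) =
  evd a (wop (sdiffs mu W) b (t + sumn mu) (coefs (van N))).
Proof.
elim: mu t W => [|r mu IH] t W Wv; first by rewrite /psums big_nil mul1r addn0.
move=> /= /andP[ar amu].
rewrite coefs_psums_cons wop_pmul_fun // {1}/evd {1}/wop onebodyD -!/(wop _ _ _ _).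
rewrite -!/(evd _ _) evd_pmul ?add0r //; last first.
  by apply: alternating_wop; exact: coefs_psumsM_alt.
by rewrite IH ?addnA //; exact: vanishing_sdiff.
Qed.

Lemma coefs_van_large (m : 'X_{1..N}) i : (N <= m i)%N -> coefs (van N) m = 0.
Proof.
move=> mN; apply/eqP/negP => /negP/coefs_van_neq0[s mE].
by move: mN; rewrite mE mnmE leqNgt ltn_ord.
Qed.

(** The composite of the two operators preserves the degree. Two moves at the same
position of the staircase contribute F(x) for each x < N. Two moves at distinct
positions contribute only if they exchange two entries at distance a, with sign
-1, which gives - F(x) for each x < N - a; the difference has a terms. *)
Lemma evd_wop_van a b W : (0 < a)%N -> (a <= N)%N ->
  evd a (wop W b (a + b) (coefs (van N))) =
  \sum_(j < a) W.[(N - a + j)%:R] * ((N + j) ^_ a)%:R.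
Proof.
move=> a0 aN; rewrite /evd /wop onebody_comp.
set S1 := (X in X + _); set S2 := (X in _ + X).
pose F x := W.[x%:R] * ((x + a) ^_ a)%:R.
have -> : S1 = \sum_(0 <= x < N) F x.
  rewrite big_mkord; apply: eq_bigr => i _.
  rewrite !mnmE /= !subn0 !ffpolyE ifT; last by lia.
  have -> : upd (delta N) i (i + a + b - (a + b)) = delta N.
    by apply/mnmP => k; rewrite !mnmE; case: eqP => // ->; lia.
  rewrite coefs_van_delta mulr1 /F mulrC; congr (_.[_%:R] * _); lia.
(* two moves at i < j, the first of which raises the exponent j: then j + a is
   either too large or a repeated exponent *)
have low (i j : 'I_N) y : (i < j)%N ->
    coefs (van N) (upd (upd (delta N) j (j + a)) i y) = 0.
  move=> ij; have ji : j != i by rewrite -val_eqE /= gtn_eqF.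
  have [jN|Nj] := ltnP (j + a) N; last first.
    by apply: (@coefs_van_large _ j); rewrite !mnmE (negPf ji) eqxx.
  apply: (alternating_repeat (i := j) (j := Ordinal jN) (alternating_van (N := N))).
    by rewrite -val_eqE /= ltn_eqF //; lia.
  by rewrite !mnmE (negPf ji) eqxx -!val_eqE /= !gtn_eqF //; lia.
(* the exponent i is raised to i + a, which is a repeated exponent unless it is
   the entry j that is lowered *)
have high (i j : 'I_N) : (i < j)%N -> (a <= j)%N ->
    coefs (van N) (upd (upd (delta N) i (i + a)) j (j - a)) = - ((j : nat) == i + a)%N%:R.
  move=> ij aj; have nij : i != j by rewrite -val_eqE /= ltn_eqF.
  have [jE|jE] := eqVneq (j : nat) (i + a)%N.
    rewrite -(coefs_van_delta N) -(alternating_van _ nij); congr (coefs _ _).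
    apply/mnmP => k; rewrite !mnmE; case: tpermP => [->|->|/eqP ki /eqP kj].
    - by rewrite (negPf nij) eqxx jE.
    - by rewrite eqxx; lia.
    by rewrite (negPf ki) (negPf kj).
  rewrite oppr0; have [iN|Ni] := ltnP (i + a) N; last first.
    by apply: (@coefs_van_large _ i); rewrite !mnmE (negPf nij) eqxx.
  apply: (alternating_repeat (i := i) (j := Ordinal iN) (alternating_van (N := N))).
    by rewrite -val_eqE /= ltn_eqF //; lia.
  rewrite !mnmE (negPf nij) eqxx -!val_eqE /= eq_sym (negPf jE).
  by rewrite gtn_eqF //; lia.
have -> : S2 = - \sum_(0 <= x < N - a) F x.
  have -> : S2 = \sum_(i < N | (i < N - a)%N) - F i.
    rewrite [RHS]big_mkcond; apply: eq_bigr => i _.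
    transitivity (\sum_(j < N | (i < j)%N) - (((j : nat) == i + a)%N%:R * F i)).
      apply: eq_bigr => j ij; rewrite !mnmE !ffpolyE !subn0 (low i j) // mulr0 addr0.
      case: (leqP (a + b) (j + b)) => aj; last first.
        by rewrite mulr0 mul0r [_ == _](_ : _ = false) ?mul0r ?oppr0 //; lia.
      have -> : (j + b - (a + b) = j - a)%N by lia.
      rewrite high; [|lia|lia]; case: eqP => [->|_]; last by rewrite oppr0 mulr0 mul0r oppr0.
      rewrite mul1r mulrN1 /F mulrC; congr (- (_.[_%:R] * _)); lia.
    case: ltnP => iN; last first.
      rewrite big1 // => j _; rewrite [_ == _](_ : _ = false) ?mul0r ?oppr0 //.
      by have := ltn_ord j; lia.
    have jN : (i + a < N)%N by lia.
    rewrite (bigD1 (Ordinal jN)) /=; last by lia.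
    rewrite eqxx mul1r big1 ?addr0 // => j /andP[_]; rewrite -val_eqE /= => /negPf ->.
    by rewrite mul0r oppr0.
  by rewrite sumrN big_mkord (big_ord_widen N F) ?leq_subr.
rewrite (big_cat_nat _ (n := N - a)) ?leq_subr //= [X in X - _]addrC addrK.
rewrite -{1}[(N - a)%N]add0n big_addn big_mkord.
have -> : (N - (N - a) = a)%N by lia.
apply: eq_bigr => j _; rewrite /F [(j + _)%N]addnC; congr (_ * (_ ^_ _)%:R); lia.
Qed.

Lemma evd_connpoly a b mu : (0 < a)%N -> (a <= N)%N ->
  evd a (wop (sdiffs mu (ffpoly b)) b (a + b) (coefs (van N))) =
  (connpoly a b mu).[N%:R].
Proof.
move=> a0 aN; rewrite evd_wop_van // /connpoly horner_sum; apply: eq_bigr => j _.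
by rewrite hornerM !horner_comp !hornerE -natrB // -!natrD ffpolyE.
Qed.

Lemma pairing_two_evd a b mu :
  pairing N [:: a; b] mu = evd a (wop (ffpoly b) b 0 (coefs (psums N mu * van N))).
Proof. by rewrite /pairing /evd /= !coefs_dpow_wop. Qed.

Lemma pairing_one_evd b mu : pairing N [:: b] mu = evd b (coefs (psums N mu * van N)).
Proof. by rewrite /pairing /evd /= coefs_dpow_wop. Qed.

Theorem pairing_large_parts a b mu :
  (0 < a)%N -> (a <= N)%N -> all (leq a.+1) mu -> sumn mu = (a + b)%N ->
  pairing N [:: a; b] mu = (connpoly a b mu).[N%:R].
Proof.
move=> a0 aN amu smu.
rewrite pairing_two_evd evd_wop_psums //; last exact: vanishing_ffpoly.
by rewrite add0n smu evd_connpoly.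
Qed.

Lemma wop_diag b W phi m :
  wop W b b phi m = (\sum_(i < N) W.[(m i)%:R]) * phi m.
Proof.
rewrite mulr_suml; apply: eq_bigr => i _.
by rewrite leq_addl addnK upd_id.
Qed.

(** An operator that preserves each exponent is diagonal on monomials; as its value is
symmetric in the exponents, it acts on the Vandermonde product as a scalar. *)
Lemma wop_diag_van b W :
  wop W b b (coefs (van N)) = (fun m => (\sum_(i < N) W.[i%:R]) * coefs (van N) m).
Proof.
apply: boolp.funext => m; rewrite wop_diag.
have [->|/coefs_van_neq0[s ->]] := eqVneq (coefs (van N) m) 0; first by rewrite !mulr0.
congr (_ * _); rewrite [RHS](reindex_inj (@perm_inj _ s)) /=.
by apply: eq_bigr => i _; rewrite mnmE.
Qed.

Lemma pairing_cycle b : (0 < b)%N ->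
  pairing N [:: b] [:: b] = \sum_(i < N) (sdiff b (ffpoly b)).[i%:R].
Proof.
move=> b0; rewrite pairing_one_evd /evd coefs_psums_cons wop_pmul; last exact: vanishing_ffpoly.
rewrite pmul_at_delta //; last by apply: alternating_wop; exact: coefs_psumsM_alt.
by rewrite add0r add0n /psums big_nil mul1r wop_diag_van coefs_van_delta mulr1.
Qed.

(** As in [evd_wop_psums], the multiplications by p_b and p_a are moved to the left.
The commutator of p_b with the inner operator has degree 0 and acts as a scalar,
so that besides its commutator with p_a the product with p_a contributes: this is the
product of the two one-cycle pairings. If a = b, the commutator of p_b with the
outer operator has degree 0 too and gives the same product again. *)
Theorem pairing_two_cycles a b :
  (0 < a)%N -> (a <= b)%N -> (a <= N)%N ->
  pairing N [:: a; b] [:: b; a] =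
    (connpoly a b [:: b; a]).[N%:R]
    + (1 + (a == b))%N%:R * (pairing N [:: a] [:: a] * pairing N [:: b] [:: b]).
Proof.
move=> a0 ab aN; have b0 : (0 < b)%N by apply: leq_trans ab.
pose phi := coefs (psums N [:: a] * van N).
have alt_phi : alternating phi by exact: coefs_psumsM_alt.
have alt_v : alternating (coefs (van N)) by exact: alternating_van.
have vb := @vanishing_ffpoly b; have va := @vanishing_ffpoly a.
have split1 : pairing N [:: a; b] [:: b; a] =
    evd a (pmul b (wop (ffpoly b) b 0 phi)) + evd a (wop (sdiff b (ffpoly b)) b b phi).
  rewrite pairing_two_evd coefs_psums_cons wop_pmul_fun // add0n.
  by rewrite {1}/evd {1}/wop onebodyD.
have second : evd a (wop (sdiff b (ffpoly b)) b b phi) =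
   pairing N [:: a] [:: a] * pairing N [:: b] [:: b] + (connpoly a b [:: b; a]).[N%:R].
  rewrite /phi coefs_psums_cons {1}/psums big_nil mul1r.
  rewrite wop_pmul_fun; last exact: (vanishing_sdiff (r := b) vb).
  rewrite {1}/evd {1}/wop onebodyD -!/(wop _ _ _ _) -!/(evd _ _).
  rewrite [(b + a)%N]addnC -[sdiff a _]/(sdiffs [:: b; a] (ffpoly b)) evd_connpoly //.
  congr (_ + _).
  rewrite wop_diag_van -pairing_cycle // mulrC (pairing_one_evd a) coefs_psums_cons.
  rewrite /psums big_nil mul1r; set c := pairing N [:: b] [:: b].
  have -> : pmul a (fun m => c * coefs (van N) m) = fun m => c * pmul a (coefs (van N)) m.
    by apply: boolp.funext => m; rewrite /pmul onebodyZ.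
  by rewrite /evd /wop onebodyZ.
rewrite split1 second addrA addrC; congr (_ + _).
have [abE|nab] := eqVneq a b; last first.
  rewrite evd_pmul ?add0r ?mul1r //; last by rewrite ltn_neqAle nab.
  exact: alternating_wop.
suff -> : evd a (pmul b (wop (ffpoly b) b 0 phi)) =
   pairing N [:: a] [:: a] * pairing N [:: b] [:: b] by rewrite natrD mulrDl !mul1r.
rewrite -abE /evd wop_pmul // pmul_at_delta //; last by do 2! apply: alternating_wop.
rewrite add0r add0n wop_diag; congr (_ * _); last by rewrite pairing_one_evd.
by rewrite pairing_cycle //; apply: eq_bigr => i _; rewrite mnmE.
Qed.

End Evaluation.

(** * Products of cycles *)

Lemma big_picks_fst (A : Type) (V : nmodType) (s : seq A) (F : A -> V) :
  \sum_(p <- picks s) F p.1 = \sum_(a <- s) F a.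
Proof.
elim: s => [|a s IH]; first by rewrite !big_nil.
by rewrite big_picks_cons big_cons /= IH.
Qed.

Lemma big_picks_map (A B : Type) (V : nmodType) (f : A -> B) (s : seq A)
    (F : B * seq B -> V) :
  \sum_(p <- picks (map f s)) F p = \sum_(p <- picks s) F (f p.1, map f p.2).
Proof.
elim: s F => [|a s IH] F; first by rewrite !big_nil.
by rewrite map_cons !big_picks_cons IH.
Qed.

Section Cycles.
Variable T : finType.
Implicit Types (x y g h : T) (l t : seq T) (bs : seq (seq T)) (s u v : {perm T}) (A : {set T}).
Local Open Scope group_scope.

(** The cycle that sends each entry to the next one. Building it from transpositions
makes cuts and joins of cycles a matter of splitting lists ([cyc_split]). *)
Fixpoint cyc l : {perm T} :=
  if l is x :: l' then (if l' is y :: _ then cyc l' * tperm x y else 1) else 1.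

Definition cycs bs : {perm T} := \prod_(b <- bs) cyc b.

Lemma cycs_cons b bs : cycs (b :: bs) = cyc b * cycs bs.
Proof. by rewrite /cycs big_cons. Qed.

Lemma cyc_cons2 x y l : cyc (x :: y :: l) = cyc (y :: l) * tperm x y.
Proof. by []. Qed.

Lemma perm_onS (A B : {set T}) s : A \subset B -> perm_on A s -> perm_on B s.
Proof. by move=> AB sA; apply: subset_trans AB. Qed.

Lemma cyc_on l : perm_on [set z in l] (cyc l).
Proof.
elim: l => [|x l IH]; first exact: perm_on1.
have sub : [set z in l] \subset [set z in x :: l].
  by apply/subsetP => z; rewrite !inE orbC => ->.
case: l IH sub => [|y l] IH sub; first exact: perm_on1.
rewrite cyc_cons2; apply: perm_onM; first exact: perm_onS IH.
apply: perm_onS (tperm_on x y); apply/subsetP => z; rewrite !inE.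
by case/orP => ->; rewrite ?orbT.
Qed.

Lemma cycs_on bs : perm_on [set z in flatten bs] (cycs bs).
Proof.
elim: bs => [|b bs IH]; first by rewrite /cycs big_nil perm_on1.
rewrite cycs_cons; apply: perm_onM.
  by apply: perm_onS (cyc_on b); apply/subsetP => z; rewrite !inE /= mem_cat => ->.
by apply: perm_onS IH; apply/subsetP => z; rewrite !inE /= mem_cat orbC => ->.
Qed.

Lemma cyc_out l x : x \notin l -> cyc l x = x.
Proof. by move=> xl; rewrite (out_perm (cyc_on l)) // inE. Qed.

Lemma cycs_out bs x : x \notin flatten bs -> cycs bs x = x.
Proof. by move=> xl; rewrite (out_perm (cycs_on bs)) // inE. Qed.

Lemma perm_on_commute (A B : {set T}) s u :
  perm_on A s -> perm_on B u -> (forall x, x \in A -> x \notin B) -> commute s u.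
Proof.
move=> sA uB dAB; apply: perm_onC sA uB _.
by rewrite disjoint_subset; apply/subsetP => x /dAB; rewrite inE.
Qed.

Lemma tperm_commute x h s : s x = x -> s h = h -> commute s (tperm x h).
Proof.
by move=> sx sh; rewrite /commute [RHS]conjgC tpermJ sx sh.
Qed.

(** Multiplication by a transposition of two points of a cycle cuts it before each of
these points. *)
Lemma cyc_split x t g l : uniq (x :: t ++ g :: l) ->
  cyc (x :: t ++ g :: l) * tperm x g = cyc (x :: t) * cyc (g :: l).
Proof.
elim: t x => [|h t IH] x.
  by move=> _; rewrite cat0s cyc_cons2 -mulgA tperm2 mulg1 [cyc [:: x]]/= mul1g.
move=> U; have Ux : x \notin h :: t ++ g :: l by case/andP: U.
have Uh : uniq (h :: t ++ g :: l) by case/andP: U.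
have xh : x != h by apply: contraNneq Ux => ->; rewrite mem_head.
have xg : x != g by apply: contraNneq Ux => ->; rewrite -cat_cons mem_cat mem_head orbT.
have hg : h != g.
  by apply: contraTneq Uh => ->; rewrite /= mem_cat mem_head orbT.
have xl : x \notin g :: l.
  by apply: contra Ux => xl; rewrite -cat_cons mem_cat xl orbT.
have hl : h \notin g :: l.
  by case/andP: Uh => Uh _; apply: contra Uh => hl; rewrite mem_cat hl orbT.
have -> : (h :: t) ++ g :: l = h :: t ++ g :: l by [].
rewrite cyc_cons2 -(mulgK (tperm h g) (cyc (h :: _))) IH // tpermV.
have tt : tperm h g * (tperm x h * tperm x g) = tperm x h.
  have gh : g != h by rewrite eq_sym.
  have hx : h != x by rewrite eq_sym.
  have gx : g != x by rewrite eq_sym.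
  rewrite [tperm x h * _]conjgC tpermJ tpermL tpermD // [tperm h g]tpermC -{1}[tperm g h]tpermV.
  by rewrite -conjgE tpermJ tpermL tpermD.
rewrite cyc_cons2 -!mulgA tt; congr (_ * _).
by rewrite tperm_commute // cyc_out.
Qed.

Lemma cyc_rcons t x : uniq (rcons t x) -> cyc (rcons t x) = cyc (x :: t).
Proof.
case: t => // h t; rewrite rcons_cons -cats1 => U.
rewrite -(mulgK (tperm h x) (cyc _)) cyc_split // [cyc [:: x]]/= mulg1 tpermV.
by rewrite tpermC.
Qed.

Lemma cyc_rot t l : uniq (t ++ l) -> cyc (t ++ l) = cyc (l ++ t).
Proof.
elim: t l => [|x t IH] l U; first by rewrite cats0.
have U' : uniq (rcons (t ++ l) x) by rewrite rcons_uniq.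
rewrite cat_cons -cyc_rcons // -cats1 -catA IH ?cats1 -?rcons_cat // cat_rcons.
by [].
Qed.

Lemma cyc_to g l : g \in l -> uniq l ->
  exists l', [/\ cyc l = cyc (g :: l'), perm_eq l (g :: l') & uniq (g :: l')].
Proof.
case/splitPr => l1 l2 U.
exists (l2 ++ l1); have P : perm_eq (l1 ++ g :: l2) (g :: l2 ++ l1).
  by rewrite perm_catC.
by split; rewrite -?(perm_uniq P) // cyc_rot.
Qed.

Lemma cyc_next x y l : uniq (x :: y :: l) -> cyc (x :: y :: l) x = y.
Proof. by move=> /andP[xl _]; rewrite cyc_cons2 permM cyc_out // tpermL. Qed.

Lemma cycs_picks bs p : uniq (flatten bs) -> p \in picks bs ->
  cycs bs = cyc p.1 * cycs p.2.
Proof.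
elim: bs p => // b bs IH p U; rewrite inE => /orP[/eqP->|]; first exact: cycs_cons.
case/mapP => p' pp' -> /=; rewrite !cycs_cons !mulgA.
move: U; rewrite /= cat_uniq => /and3P[_ /hasPn dis U].
rewrite (IH _ U pp') !mulgA; congr (_ * _).
apply: perm_on_commute (cyc_on _) (cyc_on _) _ => x; rewrite !inE => xb.
apply: contraL xb => xp'; apply: dis.
by rewrite (perm_mem (perm_flatten (picks_perm pp'))) /= mem_cat xp'.
Qed.

Lemma cycJ l u : cyc l ^ u = cyc (map u l).
Proof.
elim: l => [|x l IH]; first by rewrite conj1g.
by case: l IH => [|y l] IH; rewrite ?conj1g // cyc_cons2 conjMg IH tpermJ.
Qed.

Lemma cycsJ bs u : cycs bs ^ u = cycs (map (map u) bs).
Proof.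
elim: bs => [|b bs IH]; first by rewrite /cycs !big_nil conj1g.
by rewrite /= !cycs_cons conjMg IH cycJ.
Qed.

Definition ncyc s := #|porbits s|.

Lemma porbitJ s u x : porbit (s ^ u) (u x) = u @: porbit s x.
Proof.
apply/setP => y; apply/porbitP/imsetP => [[i ->]|[z /porbitP[i ->] ->]].
  by exists ((s ^+ i) x); rewrite ?mem_porbit // -conjXg permJ.
by exists i; rewrite -conjXg permJ.
Qed.

Lemma ncycJ s u : ncyc (s ^ u) = ncyc s.
Proof.
rewrite /ncyc -[RHS](card_imset _ (imset_inj (@perm_inj _ u))).
congr #|pred_of_set _|; apply/setP => C; apply/idP/idP.
  case/imsetP => x _ ->; apply/imsetP; exists (porbit s (u^-1 x)); first exact: imset_f.
  by rewrite -porbitJ permKV.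
case/imsetP => D DP ->; case/imsetP: DP => x _ ->; rewrite -porbitJ.
exact: imset_f.
Qed.

Lemma ncycC s u : ncyc (s * u) = ncyc (u * s).
Proof. by rewrite -(ncycJ (u * s) u) conjgE -[u * s * u]mulgA mulKg. Qed.

Lemma ncycV s : ncyc s^-1 = ncyc s.
Proof. by rewrite /ncyc porbitsV. Qed.

Lemma ncyc_tperm s x h : s x = x -> x != h -> (ncyc (tperm x h * s)).+1 = ncyc s.
Proof.
move=> sx xh; have xs : x \notin porbit s h.
  rewrite porbit_sym; apply/negP => /porbitP[i hE].
  move: xh; rewrite hE; suff -> : (s ^+ i) x = x by rewrite eqxx.
  by elim: i {hE} => [|i IH]; rewrite ?expg0 ?perm1 // expgSr permM IH.
by have := porbits_mul_tperm s x h; rewrite /= xh xs addn1 addn2 => -[].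
Qed.

(** The point [x] is a cycle of its own for s * u, and the transposition merges it into
the cycle of [h]. *)
Lemma ncyc_insert s u x h : s x = x -> u x = x -> x != h ->
  (ncyc (s * tperm x h * u)).+1 = ncyc (s * u).
Proof.
move=> sx ux xh; have -> : ncyc (s * tperm x h * u) = ncyc (tperm x h * (u * s)).
  by rewrite mulgA [in RHS]ncycC mulgA.
by rewrite ncyc_tperm // ?permM ?ux // ncycC.
Qed.

End Cycles.

(** * Sums over conjugates *)

Section ConjugateSums.
Variables (T : finType) (N : nat).
Hypothesis N0 : (0 < N)%N.
Implicit Types (x y g h : T) (l t : seq T) (bs : seq (seq T)) (s u v : {perm T}).
Implicit Types (A : {set T}) (nu rho : seq nat).

(** The cycles are kept in a list, so that [rho] is a list of lengths in a chosen
order. Fixed points count as cycles of length one, which makes A the union of the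
cycles. *)
Definition shaped A rho s :=
  exists bs, [/\ uniq (flatten bs), flatten bs =i A, map size bs = rho,
                 all (leq 1) rho & s = cycs bs].

Lemma shaped_on A rho s : shaped A rho s -> s \in Sym A.
Proof.
case=> bs [_ bsA _ _ ->]; rewrite inE; apply: perm_onS (cycs_on bs).
by apply/subsetP => z; rewrite inE bsA.
Qed.

Lemma in_Sym A u : (u \in Sym A) = perm_on A u.
Proof. by rewrite inE. Qed.

(** Only the permutations of A are averaged over, but the cycles are counted in the
whole type: points outside A contribute fixed points, hence the power of N in
[csum_pairing]. *)
Definition csum A (c s : {perm T}) : rat :=
  \sum_(u in Sym A) N%:R ^+ ncyc (s ^ u * c^-1)%g.

Lemma Sym_fix A u x : u \in Sym A -> x \notin A -> u x = x.
Proof. by rewrite inE => uA xA; rewrite (out_perm uA). Qed.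

(** The permutations of x |: A that send a given [r] to [x] form the coset of those
of A by the transposition of [r] and [x]. *)
Lemma big_Sym_setU1 (V : nmodType) A x (F : {perm T} -> V) : x \notin A ->
  \sum_(u in Sym (x |: A)) F u =
    \sum_(r in x |: A) \sum_(u in Sym A) F (tperm r x * u)%g.
Proof.
move=> xA; rewrite (partition_big (fun u : {perm T} => (u^-1)%g x) (mem (x |: A))) /=; last first.
  by move=> u; rewrite in_Sym => uA; rewrite (perm_closed _ (perm_onV uA)) setU11.
apply: eq_bigr => r rA; rewrite (reindex_inj (mulgI (tperm r x))) /=.
apply: eq_bigl => u; rewrite invMg tpermV permM.
have tA : perm_on (x |: A) (tperm r x).
  by apply: perm_onS (tperm_on r x); rewrite subUset !sub1set rA setU11.
apply/andP/idP => [[uA /eqP ur]|uA].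
  have ux : u x = x.
    have uVx : (u^-1)%g x = x by rewrite -[LHS](tpermK r x) ur tpermL.
    by rewrite -{1}uVx permKV.
  rewrite in_Sym; have uA' : perm_on (x |: A) u.
    rewrite in_Sym in uA; by rewrite -[u](mulKg (tperm r x)) tpermV; apply: perm_onM.
  apply/subsetP => z zu; have := subsetP uA' _ zu; rewrite !inE => /orP[/eqP zx|//].
  by move: zu; rewrite inE zx ux eqxx.
have ux : u x = x by apply: Sym_fix uA xA.
have uVx : (u^-1)%g x = x by rewrite -{1}ux permK.
split; last by rewrite uVx tpermR.
rewrite in_Sym; apply: perm_onM => //; move: uA; rewrite in_Sym; apply: perm_onS.
exact: subsetUr.
Qed.

Lemma tperm_mul_conj (s u : {perm T}) r x r' : u x = x ->
  ((s ^ (tperm r x * u)) * tperm x (u r') = (s ^ tperm r x * tperm x r') ^ u)%g.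
Proof. by move=> ux; rewrite [RHS]conjMg tpermJ ux -conjgM. Qed.

Lemma csum_setU1 A x c s : x \notin A ->
  csum (x |: A) c s =
    \sum_(r in x |: A) \sum_(u in Sym A) N%:R ^+ ncyc ((s ^ tperm r x) ^ u * c^-1)%g.
Proof.
move=> xA; rewrite /csum big_Sym_setU1 //.
by apply: eq_bigr => r _; apply: eq_bigr => u _; rewrite conjgM.
Qed.

(** After the sum over the [u] in [Sym A], a transposition of [x] with [g] on the
right of [c] may be moved to [s], because [u] fixes [x]. *)
Lemma csum_insert A x c s : x \notin A ->
  \sum_(g in A) csum (x |: A) (c * tperm x g)%g s =
    \sum_(r in x |: A) \sum_(r' in A) \sum_(u in Sym A)
       N%:R ^+ ncyc ((s ^ tperm r x * tperm x r') ^ u * c^-1)%g.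
Proof.
move=> xA; rewrite /csum; under eq_bigr => g gA do rewrite big_Sym_setU1 //.
rewrite exchange_big /=; apply: eq_bigr => r rA.
rewrite exchange_big /= [RHS]exchange_big /=; apply: eq_bigr => u uA.
have ux : u x = x by apply: Sym_fix uA xA.
rewrite (reindex_inj (@perm_inj _ u)) /=.
apply: eq_big => [g|g gA]; first by move: uA; rewrite inE => uA; rewrite (perm_closed _ uA).
by rewrite -tperm_mul_conj // invMg tpermV mulgA.
Qed.

Variables (A : {set T}) (x : T) (c : {perm T}) (K : rat) (H : seq nat -> rat).
Hypotheses (xA : x \notin A) (cA : c \in Sym A).
Hypothesis H0 : forall rho, H (0%N :: rho) = N%:R * H rho.
Hypothesis claim : forall rho s, shaped A rho s -> csum A c s = K * H rho.

(** If [x] is inserted in a cycle of a permutation of A, one cycle of the product is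
lost; if [x] is a cycle by itself, the formula is the same with the convention
that a part 0 stands for a factor N. *)
Lemma csum_head t bs : uniq (t ++ flatten bs) -> t ++ flatten bs =i A ->
  all (leq 1) (map size bs) ->
  \sum_(u in Sym A) N%:R ^+ ncyc ((cyc (x :: t) * cycs bs) ^ u * c^-1)%g =
    N%:R^-1 * K * H (size t :: map size bs).
Proof.
move=> U tA bs0; have q0 : N%:R != 0 :> rat by rewrite pnatr_eq0 -lt0n.
case: t U tA => [|h t] U tA.
  have -> : N%:R^-1 * K * H (size (Nil T) :: map size bs) = K * H (map size bs).
    by rewrite H0; field.
  by rewrite [cyc _]/= mul1g -(claim (s := cycs bs)) //; exists bs; split.
rewrite [cyc _]/= -/(cyc (h :: t)).
have xtb : x \notin h :: t ++ flatten bs by rewrite -cat_cons tA.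
have hA : h \in A by rewrite -tA mem_head.
have E : (cyc (h :: t) * tperm x h * cycs bs = cycs ((h :: t) :: bs) * tperm x h)%g.
  rewrite cycs_cons -!mulgA; congr (_ * _)%g; apply/esym; apply: tperm_commute.
    by rewrite cycs_out //; apply: contra xtb => xb; rewrite inE mem_cat xb !orbT.
  rewrite cycs_out //; move: U => /= /andP[hn _]; apply: contra hn => hb.
  by rewrite mem_cat hb orbT.
rewrite -mulrA -(claim (s := cycs ((h :: t) :: bs))); last by exists ((h :: t) :: bs).
rewrite E /csum mulr_sumr; apply: eq_bigr => u uA.
have ux : u x = x by apply: Sym_fix uA xA.
have uh : u h \in A by move: uA; rewrite inE => uA; rewrite (perm_closed _ uA).
rewrite conjMg tpermJ ux -(@ncyc_insert _ (cycs ((h :: t) :: bs) ^ u)%g c^-1%g x (u h)).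
- by rewrite exprS mulrA mulVf // mul1r.
- by rewrite -{1}ux permJ cycs_out ?ux.
- by rewrite -{1}(Sym_fix cA xA) permK.
by apply: contraNneq xA => ->.
Qed.

Lemma tperm_cycs_commute bs r' : x \notin flatten bs -> r' \notin flatten bs ->
  commute (cycs bs) (tperm x r').
Proof. by move=> xb rb; apply: tperm_commute; rewrite cycs_out. Qed.

(** The transposition of [x] with a point of its own cycle cuts this cycle, and
[x] stays in the first part. *)
Lemma csum_head_cut t1 r' t2 bs :
  uniq (t1 ++ r' :: t2 ++ flatten bs) -> t1 ++ r' :: t2 ++ flatten bs =i A ->
  all (leq 1) (map size bs) ->
  \sum_(u in Sym A) N%:R ^+ ncyc ((cyc (x :: t1 ++ r' :: t2) * cycs bs * tperm x r') ^ u
     * c^-1)%g = N%:R^-1 * K * H [:: size t1, (size t2).+1 & map size bs].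
Proof.
move=> U tA bs0; have xtb : x \notin t1 ++ r' :: t2 ++ flatten bs by rewrite tA.
have Uall : uniq (x :: (t1 ++ r' :: t2) ++ flatten bs).
  by rewrite -catA cons_uniq [_ \notin _]xtb.
have rb : r' \notin flatten bs.
  move: U; rewrite cat_uniq => /and3P[_ _ /= /andP[+ _]].
  by rewrite mem_cat negb_or => /andP[].
have xb : x \notin flatten bs.
  by apply: contra xtb => xb; rewrite mem_cat inE mem_cat xb !orbT.
have -> : (cyc (x :: t1 ++ r' :: t2) * cycs bs * tperm x r' =
           cyc (x :: t1) * cycs ((r' :: t2) :: bs))%g.
  rewrite cycs_cons -mulgA tperm_cycs_commute // !mulgA; congr (_ * _)%g.
  by apply: cyc_split; move: Uall; rewrite -cat_cons cat_uniq => /and3P[].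
by rewrite csum_head.
Qed.

(** The transposition of [x] with a point of another cycle joins the two cycles. *)
Lemma csum_head_join t bs p r' : uniq (t ++ flatten bs) -> t ++ flatten bs =i A ->
  all (leq 1) (map size bs) -> p \in picks bs -> r' \in p.1 ->
  \sum_(u in Sym A) N%:R ^+ ncyc ((cyc (x :: t) * cycs bs * tperm x r') ^ u * c^-1)%g =
    N%:R^-1 * K * H ((size t + size p.1)%N :: map size p.2).
Proof.
move=> U tA bs0 pp rp; have P := perm_flatten (picks_perm pp).
have pU : uniq (t ++ p.1 ++ flatten p.2).
  by rewrite -(perm_uniq (perm_cat (perm_refl t) P)).
have pA : t ++ p.1 ++ flatten p.2 =i A.
  by move=> z; rewrite -tA !mem_cat (perm_mem P) /= mem_cat.
have Ub : uniq (flatten bs) by move: U; rewrite cat_uniq => /and3P[].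
have p0 : all (leq 1) (map size p.2).
  by move: bs0; rewrite (perm_all _ (perm_map size (picks_perm pp))) => /andP[].
have Up : uniq p.1 by move: pU; rewrite !cat_uniq => /and4P[_ _].
have [l [pE Pl Ul]] := cyc_to rp Up.
have PP : perm_eq (t ++ p.1 ++ flatten p.2) ((t ++ r' :: l) ++ flatten p.2).
  by rewrite -catA perm_cat2l perm_cat2r.
have U2 : uniq ((t ++ r' :: l) ++ flatten p.2) by rewrite -(perm_uniq PP).
have A2 : (t ++ r' :: l) ++ flatten p.2 =i A by move=> z; rewrite -(perm_mem PP) pA.
have xall : x \notin (t ++ r' :: l) ++ flatten p.2 by rewrite A2.
have xb : x \notin flatten p.2 by apply: contra xall; rewrite mem_cat => ->; rewrite orbT.
have rb : r' \notin flatten p.2.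
  move: U2; rewrite cat_uniq => /and3P[_ /hasPn dis _]; apply/negP => /dis.
  by rewrite mem_cat mem_head orbT.
have Ux : uniq (x :: t ++ r' :: l).
  move: U2 xall; rewrite cat_uniq mem_cat negb_or /= => /and3P[-> _ _] /andP[-> _].
  by [].
have -> : (cyc (x :: t) * cycs bs * tperm x r' = cyc (x :: t ++ r' :: l) * cycs p.2)%g.
  rewrite (cycs_picks Ub pp) pE -!mulgA tperm_cycs_commute // !mulgA; congr (_ * _)%g.
  by rewrite -cyc_split // -mulgA tperm2 mulg1.
by rewrite csum_head // size_cat -(perm_size Pl).
Qed.

Lemma csum_head_insert t bs : uniq (t ++ flatten bs) -> t ++ flatten bs =i A ->
  all (leq 1) (map size bs) ->
  \sum_(r' in A) \sum_(u in Sym A)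
      N%:R ^+ ncyc ((cyc (x :: t) * cycs bs * tperm x r') ^ u * c^-1)%g =
    N%:R^-1 * K *
    (\sum_(l < size t) H [:: (size t - l.+1)%N, l.+1 & map size bs]
     + \sum_(p <- picks (map size bs)) p.1%:R * H ((size t + p.1)%N :: p.2)).
Proof.
move=> U tA bs0.
pose f r' := \sum_(u in Sym A)
  N%:R ^+ ncyc ((cyc (x :: t) * cycs bs * tperm x r') ^ u * c^-1)%g : rat.
rewrite -[LHS]/(\sum_(r' in A) f r').
rewrite (eq_bigl (mem (t ++ flatten bs))); last by move=> r'; rewrite -tA.
rewrite -big_uniq // big_cat big_flatten /= mulrDr; congr (_ + _).
  rewrite (big_nth x) big_mkord (reindex_inj rev_ord_inj) mulr_sumr /=.
  apply: eq_bigr => l _; set k := (size t - l.+1)%N.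
  have kt : (k < size t)%N by have := ltn_ord l; rewrite /k; lia.
  have E : t = take k t ++ nth x t k :: drop k.+1 t by rewrite -drop_nth // cat_take_drop.
  have := @csum_head_cut (take k t) (nth x t k) (drop k.+1 t) bs.
  have E2 : take k t ++ nth x t k :: drop k.+1 t ++ flatten bs = t ++ flatten bs.
    by rewrite -cat_cons catA -drop_nth // cat_take_drop.
  rewrite E2 -E /f => -> //.
  rewrite size_takel ?(ltnW kt) // size_drop.
  by have -> : (size t - k.+1 = l)%N by have := ltn_ord l; rewrite /k; lia.
rewrite big_picks_map /= mulr_sumr -(big_picks_fst bs (fun b => \sum_(r' <- b) f r')).
apply: eq_big_seq => p pp.
rewrite (eq_big_seq (fun=> N%:R^-1 * K * H ((size t + size p.1)%N :: map size p.2))).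
  by rewrite big_const_seq count_predT iter_addr_0 /= -[LHS]mulr_natl mulrCA.
by move=> r' rp; exact: csum_head_join.
Qed.

(** Conjugation by the transposition of [r] and [x] puts [x] at the place of [r]. The
cycle of [r] is written from that point on, and the other cycles form a product on
the rest of A. *)
Lemma conj_to_head bs p r : uniq (flatten bs) -> flatten bs =i x |: A ->
  p \in picks bs -> r \in p.1 ->
  exists t bs', [/\ (cycs bs ^ tperm r x = cyc (x :: t) * cycs bs')%g,
     uniq (t ++ flatten bs'), t ++ flatten bs' =i A,
     size t = (size p.1).-1 & map size bs' = map size p.2].
Proof.
move=> U bsA pp rp; have P := perm_flatten (picks_perm pp).
have Up : uniq p.1 by move: U; rewrite (perm_uniq P) cat_uniq => /and3P[].
have [l [pE Pl Ul]] := cyc_to rp Up.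
pose tau := tperm r x; exists (map tau l), (map (map tau) p.2).
have PP : perm_eq (flatten bs) (r :: l ++ flatten p.2).
  by rewrite (perm_trans P) // -cat_cons perm_cat2r.
have E : x :: map tau l ++ flatten (map (map tau) p.2) = map tau (r :: l ++ flatten p.2).
  by rewrite /= map_cat map_flatten tpermL.
have Uall : uniq (x :: map tau l ++ flatten (map (map tau) p.2)).
  by rewrite E map_inj_uniq -?(perm_uniq PP) //; exact: perm_inj.
split.
- by rewrite (cycs_picks U pp) pE conjMg cycJ cycsJ /= tpermL.
- by case/andP: Uall.
- move=> z; have [->|zx] := eqVneq z x; first by case/andP: Uall => /negPf -> _; rewrite (negPf xA).
  transitivity (z \in x :: map tau l ++ flatten (map (map tau) p.2)).
    by rewrite inE (negPf zx).
  have tA : perm_on (x |: A) tau.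
    apply: perm_onS (tperm_on r x); rewrite subUset !sub1set setU11 -bsA.
    by rewrite (perm_mem PP) mem_head.
  rewrite E -{1}[z](tpermK r x) mem_map; last exact: perm_inj.
  by rewrite -(perm_mem PP) bsA (perm_closed _ tA) !inE (negPf zx).
- by rewrite size_map (perm_size Pl).
by rewrite -map_comp; apply: eq_map => b; rewrite /= size_map.
Qed.

(** A sum over points whose term depends only on the cycle of the point. *)
Lemma csum_blocks (V : seq nat -> rat) (G : T -> rat) bs :
  uniq (flatten bs) -> flatten bs =i x |: A ->
  (forall p r, p \in picks bs -> r \in p.1 -> G r = V (size p.1 :: map size p.2)) ->
  \sum_(r in x |: A) G r =
    \sum_(p <- picks (map size bs)) p.1%:R * V (p.1 :: p.2).
Proof.
move=> U bsA GV; rewrite (eq_bigl (mem (flatten bs))); last by move=> r; rewrite -bsA.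
rewrite -big_uniq // big_flatten big_picks_map /=.
rewrite -(big_picks_fst bs (fun b => \sum_(r <- b) G r)).
apply: eq_big_seq => p pp; rewrite (eq_big_seq (fun=> V (size p.1 :: map size p.2))).
  by rewrite big_const_seq count_predT iter_addr_0 /= -[LHS]mulr_natl.
by move=> r rp; exact: GV.
Qed.

Lemma csum_fixed_step rho s : shaped (x |: A) rho s ->
  csum (x |: A) c s =
    N%:R^-1 * K * \sum_(p <- picks rho) p.1%:R * H (p.1.-1 :: p.2).
Proof.
case=> bs [U bsA <- bs0 ->]; rewrite csum_setU1 // mulr_sumr.
rewrite (csum_blocks (V := fun l : seq nat => N%:R^-1 * K * H ((head 0 l).-1 :: behead l)) U bsA).
  by apply: eq_bigr => p _; rewrite /= mulrCA.
move=> p r pp rp; have [t [bs' [-> tU tA st sbs]]] := conj_to_head U bsA pp rp.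
rewrite csum_head // sbs ?st //.
by move: bs0; rewrite (perm_all _ (perm_map size (picks_perm pp))) => /andP[].
Qed.

Lemma csum_insert_step rho s : shaped (x |: A) rho s ->
  \sum_(g in A) csum (x |: A) (c * tperm x g)%g s =
    N%:R^-1 * K * \sum_(p <- picks rho) p.1%:R *
     (\sum_(l < p.1.-1) H [:: (p.1.-1 - l.+1)%N, l.+1 & p.2]
      + \sum_(p' <- picks p.2) p'.1%:R * H ((p.1.-1 + p'.1)%N :: p'.2)).
Proof.
case=> bs [U bsA <- bs0 ->]; rewrite csum_insert // mulr_sumr.
rewrite (csum_blocks (V := fun l : seq nat => N%:R^-1 * K *
     (\sum_(i < (head 0 l).-1) H [:: ((head 0 l).-1 - i.+1)%N, i.+1 & behead l]
      + \sum_(p' <- picks (behead l)) p'.1%:R * H (((head 0 l).-1 + p'.1)%N :: p'.2))) U bsA).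
  by apply: eq_bigr => p _; rewrite /= mulrCA.
move=> p r pp rp; have [t [bs' [-> tU tA st sbs]]] := conj_to_head U bsA pp rp.
rewrite csum_head_insert // sbs ?st //.
by move: bs0; rewrite (perm_all _ (perm_map size (picks_perm pp))) => /andP[].
Qed.

End ConjugateSums.

Section FrobeniusFormula.
Variables (T : finType) (N : nat).
Hypothesis N0 : (0 < N)%N.
Implicit Types (x y g : T) (bs : seq (seq T)) (s u v c : {perm T}).
Implicit Types (A : {set T}) (nu rho : seq nat).

Lemma csumJ A c s v : v \in Sym A -> csum N A (c ^ v)%g s = csum N A c s.
Proof.
move=> vA; rewrite /csum (reindex_inj (mulIg v)) /=.
apply: eq_big => [u|u _]; first by rewrite (groupMr (G := Sym_group A)).
by rewrite -conjVg conjgM -conjMg ncycJ.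
Qed.

(** Conjugation by [c] moves the insertion point along its cycle, and the sum does not
change since [c] is a permutation of A. So the sum depends only on the cycle in
which [x] is inserted. *)
Lemma csum_slide A x c g s : x \notin A -> c \in Sym A ->
  csum N (x |: A) (c * tperm x (c g))%g s = csum N (x |: A) (c * tperm x g)%g s.
Proof.
move=> xA cA; have cx := Sym_fix cA xA.
rewrite -(@csumJ _ (c * tperm x g)%g _ c).
  by rewrite conjMg tpermJ cx conjgE mulKg.
by move: cA; rewrite !in_Sym; apply: perm_onS; exact: subsetUr.
Qed.

Lemma csum_slide_block A x g l bs s : x \notin A -> uniq ((g :: l) ++ flatten bs) ->
  (g :: l) ++ flatten bs =i A ->
  forall h, h \in g :: l ->
  csum N (x |: A) (cyc (g :: l) * cycs bs * tperm x h)%g s =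
  csum N (x |: A) (cyc (g :: l) * cycs bs * tperm x g)%g s.
Proof.
move=> xA U lA h hl.
have cA : (cyc (g :: l) * cycs bs)%g \in Sym A.
  rewrite -cycs_cons in_Sym; apply: perm_onS (cycs_on _).
  by apply/subsetP => z; rewrite inE [flatten _]/= lA.
have Ul : uniq (g :: l) by move: U; rewrite cat_uniq => /and3P[].
rewrite -(nth_index g hl); move: hl; rewrite -index_mem.
elim: (index h (g :: l)) => // i IH il.
rewrite -IH; last exact: ltnW.
rewrite -[in RHS]csum_slide //; congr (csum _ _ (_ * tperm _ _)%g _).
have E : g :: l = take i (g :: l) ++ nth g (g :: l) i :: nth g (g :: l) i.+1
                  :: drop i.+2 (g :: l).
  by rewrite -!drop_nth ?cat_take_drop // ltnW.
set l1 := take i _ in E; set a := nth _ _ i in E *; set b := nth _ _ i.+1 in E *.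
rewrite permM {1}E cyc_rot -?E // cat_cons cyc_next.
  rewrite cycs_out //; move: U; rewrite cat_uniq => /and3P[_ /hasPn dis _].
  by apply/negP => /dis; rewrite E mem_cat !inE eqxx !orbT.
by rewrite -!cat_cons -(perm_uniq (permEl (perm_catC _ _))) -E.
Qed.

Lemma ncyc1 : ncyc (1 : {perm T})%g = #|T|.
Proof.
rewrite /ncyc /porbits card_imset // => x y.
have p1 z : porbit (1 : {perm T})%g z = [set z].
  apply/setP => w; rewrite inE; apply/porbitP/eqP => [[i ->]|->].
    by rewrite expg1n perm1.
  by exists 0%N; rewrite perm1.
by rewrite !p1 => /set1_inj.
Qed.

Lemma csum_nil A c rho s : shaped A [::] c -> shaped A rho s ->
  csum N A c s = N%:R ^+ (#|T| - #|A|) * pairing N [::] rho.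
Proof.
case=> [[|b bs] [_ bA // _ _ ->]] [bs' [U bA' <- bs0 ->]].
have A0 : A = set0 by apply/setP => z; rewrite -bA inE.
have -> : bs' = [::].
  case: bs' bA' bs0 {U} => // [[|z b] bs'] bA' //= _.
  by have := bA' z; rewrite A0 in_set0 /= mem_head.
rewrite pairing_nil mulr1 A0 cards0 subn0 /csum (big_pred1 1%g).
  by rewrite /cycs !big_nil conj1g invg1 mulg1 ncyc1.
move=> u; rewrite in_Sym; apply/idP/eqP => [uA|->]; last exact: perm_on1.
by apply: perm_on_id uA _; rewrite cards0.
Qed.

(** Induction on the number of cycles of [c], then on the length b + 1 of the first
one. Take a point [x] of that cycle. If it is a fixed point, remove it and compare
[csum_fixed_step] with [pairing_one]. Otherwise remove [x] to get c0 and consider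
all the ways of inserting [x] again: those in the first cycle give b times the sum
that is wanted, by [csum_slide_block]; those in another cycle are known by
induction, as the first cycle is then shorter; and the total is known by
[csum_insert_step]. The identity [pairing_insert] has the same form. *)
Theorem csum_pairing nu A c rho s : shaped A nu c -> shaped A rho s ->
  csum N A c s = N%:R ^+ (#|T| - #|A|) * pairing N nu rho.
Proof.
have [k] := ubnP (size nu); elim: k nu A c rho s => // k IHk [|b nu] A c rho s nuk.
  exact: csum_nil.
elim: b nu A c rho s nuk => [|b IHb] nu A c rho s nuk.
  by case=> bs [_ _ _].
case=> [[|B bs] [U bA // [szB nuE] bs0 ->]] sS; subst nu.
case: B U bA szB => [|x B] // U bA [szB].
have xBbs : x \notin B ++ flatten bs by case/andP: U.
have UB : uniq (B ++ flatten bs) by case/andP: U.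
pose A' := [set z in B ++ flatten bs].
have xA' : x \notin A' by rewrite inE.
have AE : A = x |: A' by apply/setP => z; rewrite !inE -bA.
have A'T : (#|A'| < #|T|)%N.
  by rewrite -(cardsT T) proper_card //; apply/properP; split; [exact: subsetT|exists x].
have cA : #|A| = #|A'|.+1 by rewrite AE cardsU1 xA'.
have [K KD] : exists K : rat, K = N%:R ^+ (#|T| - #|A'|) by eexists.
have KE : N%:R ^+ (#|T| - #|A|) = N%:R^-1 * K.
  rewrite KD cA subnS -(ltn_predK (n := (#|T| - #|A'|)%N) (m := 0)) ?subn_gt0 //=.
  by rewrite exprS mulKf // pnatr_eq0 -lt0n.
have pos : all (leq 1) (map size bs) by case/andP: bs0.
rewrite KE; rewrite AE in sS *.
have rho0 : all (leq 1) rho by case: sS => ? [].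
have B'A : B ++ flatten bs =i A' by move=> z; rewrite inE.
case: B szB {U bA xBbs} UB A' B'A xA' AE A'T cA KD KE sS => [|g B] szB UB A' B'A xA' AE A'T cA KD KE sS.
  rewrite -szB /= pairing_one cycs_cons [cyc _]/= mul1g.
  apply: csum_fixed_step sS => //.
  - by apply: (@shaped_on _ A' (map size bs)); exists bs.
  - by move=> r; exact: pairing_zero.
  move=> r s' sS'; rewrite KD; apply: IHk sS'; last by exists bs.
  by move: nuk; rewrite /= ltnS.
pose c0 := (cyc (g :: B) * cycs bs)%g; pose H := pairing N (b :: map size bs).
have bE : b = (size B).+1 by rewrite -szB.
have c0S : shaped A' (b :: map size bs) c0.
  exists ((g :: B) :: bs); rewrite cycs_cons; split=> //; first by rewrite -szB.
  by rewrite bE.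
have claim r s' : shaped A' r s' -> csum N A' c0 s' = K * H r.
  by move=> sS'; rewrite KD; apply: IHb sS'; rewrite //= size_map.
have other p h : p \in picks bs -> h \in p.1 ->
  csum N (x |: A') (c0 * tperm x h)%g s =
  N%:R^-1 * K * pairing N [:: (size p.1).+1, b & map size p.2] rho.
  move=> pp hp; have P := picks_perm pp.
  have -> : pairing N [:: (size p.1).+1, b & map size p.2] rho =
            pairing N [:: b, (size p.1).+1 & map size p.2] rho.
    by apply: pairing_perm => //; apply: (permEl (perm_catCA [:: _] [:: b] _)).
  rewrite -KE -AE; apply: IHb.
  - by move: nuk; rewrite /= !size_map (perm_size P).
  - have PF := perm_flatten P; rewrite /= in PF.
    have Ubs : uniq (flatten bs) by move: UB; rewrite cat_uniq => /and3P[].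
    have Up : uniq p.1.
      by move: Ubs; rewrite (perm_uniq PF) cat_uniq => /and3P[].
    have [l [pE Pl Ul]] := cyc_to hp Up.
    have PA : perm_eq ((g :: B) ++ flatten bs) ((g :: B) ++ (h :: l) ++ flatten p.2).
      by rewrite perm_cat2l (perm_trans PF) // perm_cat2r.
    have P2 : perm_eq (x :: (g :: B) ++ flatten bs) ((g :: B) ++ (x :: h :: l) ++ flatten p.2).
      rewrite (perm_trans (_ : perm_eq _ (x :: (g :: B) ++ (h :: l) ++ flatten p.2))) //.
        by rewrite perm_cons.
      exact: (permEl (perm_catCA [:: x] (g :: B) _)).
    exists [:: g :: B, x :: h :: l & p.2]; split.
    + by rewrite -(perm_uniq P2) cons_uniq [_ \notin _](_ : _ = true) // B'A xA'.
    + by move=> z; rewrite -(perm_mem P2) AE inE in_setU1 B'A.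
    + by rewrite /= -szB (perm_size Pl).
    + by move: pos; rewrite /= bE (perm_all _ (perm_map size P)) => /andP[].
    rewrite !cycs_cons cyc_cons2 /c0 (cycs_picks Ubs pp) pE -!mulgA; congr (_ * (_ * _))%g.
    apply: tperm_cycs_commute.
      apply: contra xA' => xb; rewrite -B'A mem_cat (perm_mem PF) mem_cat xb.
      by rewrite !orbT.
    move: Ubs; rewrite (perm_uniq PF) cat_uniq => /and3P[_ /hasPn dis _].
    by apply/negP => /dis; rewrite hp.
  by rewrite AE.
have := csum_insert_step N0 xA' (shaped_on c0S) (@pairing_zero _ _) claim sS.
rewrite (eq_bigl (mem ((g :: B) ++ flatten bs))); last by move=> h; rewrite -B'A.
rewrite -big_uniq // big_cat big_flatten.
rewrite (eq_big_seq (fun=> csum N (x |: A') (c0 * tperm x g)%g s)); last first.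
  by move=> h hB; apply: csum_slide_block.
rewrite big_const_seq count_predT iter_addr_0.
rewrite -(big_picks_fst bs (fun b => \sum_(h <- b) csum N (x |: A') (c0 * tperm x h)%g s)).
rewrite [X in _ + X = _](eq_big_seq (fun p : seq T * seq (seq T) => N%:R^-1 * K * ((size p.1)%:R *
   pairing N [:: (size p.1).+1, b & map size p.2] rho))); last first.
  move=> p pp; rewrite (eq_big_seq (fun=> N%:R^-1 * K *
      pairing N [:: (size p.1).+1, b & map size p.2] rho)).
    by rewrite big_const_seq count_predT iter_addr_0 /= -[LHS]mulr_natl mulrCA.
  by move=> h; exact: other.
rewrite -mulr_sumr.
have -> : \sum_(p <- picks rho) p.1%:R *
     (\sum_(l < p.1.-1) H [:: (p.1.-1 - l.+1)%N, l.+1 & p.2]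
      + \sum_(p' <- picks p.2) p'.1%:R * H ((p.1.-1 + p'.1)%N :: p'.2)) =
   \sum_(p <- picks (b :: map size bs)) p.1%:R * pairing N (p.1.+1 :: p.2) rho.
  rewrite pairing_insert //; apply: eq_big_seq => -[m r] /= pp.
  have m0 : (0 < m)%N.
    by move: rho0; rewrite (perm_all _ (picks_perm pp)) => /andP[].
  case: m m0 pp => // m _ pp; congr (_ * (_ + _)).
  rewrite big_ord_recl /= subn0.
  have -> : pairing N (b :: map size bs) [:: m, 0%N & r] = N%:R * H (m :: r).
    rewrite -pairing_zero; apply: pairing_perm => //.
    exact: (permEl (perm_catCA [:: m] [:: 0%N] r)).
  by rewrite addrC addKr.
rewrite big_picks_cons big_picks_map /= mulrDr => /addIr.
rewrite -bE -[_ *+ b]mulr_natl mulrCA => E.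
have b0 : b%:R != 0 :> rat by rewrite pnatr_eq0 bE.
have -> : (cycs ((x :: g :: B) :: bs) = c0 * tperm x g)%g.
  rewrite cycs_cons cyc_cons2 /c0 -!mulgA; congr (_ * _)%g; apply/esym.
  apply: tperm_cycs_commute.
    by apply: contra xA' => xb; rewrite -B'A mem_cat xb orbT.
  move: UB; rewrite cat_uniq => /and3P[_ /hasPn dis _].
  by apply/negP => /dis; rewrite mem_head.
exact: mulfI b0 _ _ E.
Qed.

End FrobeniusFormula.

(** * Roots on vertical lines *)

Section Roots.
Implicit Types (c z w r : algC) (f p Q : {poly algC}) (ws : seq algC).

Definition roots_on_line c Q := forall z, Q != 0 -> root Q z -> 'Re z = c.

Lemma norm_lt_Re (u v : algC) : 'Im u = 'Im v -> 'Re u ^+ 2 < 'Re v ^+ 2 -> `|u| < `|v|.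
Proof.
move=> uv lt; rewrite -(ltr_pXn2r (n := 2)) ?nnegrE //.
by rewrite !normC2_Re_Im uv ltrD2r.
Qed.

Lemma norm_shift_right z r : 'Re r - 2^-1 < 'Re z -> `|z - r| < `|z + 1 - r|.
Proof.
move=> zr; have R1 : 'Re (1 : algC) = 1 by apply/Creal_ReP; rewrite rpred1.
have I1 : 'Im (1 : algC) = 0 by apply/Creal_ImP; rewrite rpred1.
apply: norm_lt_Re; rewrite !raddfB !raddfD /= ?R1 ?I1 ?addr0 //.
rewrite -subr_gt0.
have -> : ('Re z + 1 - 'Re r) ^+ 2 - ('Re z - 'Re r) ^+ 2 = 2 * ('Re z - ('Re r - 2^-1)).
  by field.
by rewrite mulr_gt0 // subr_gt0.
Qed.

Lemma norm_shift_left z r : 'Re z < 'Re r - 2^-1 -> `|z + 1 - r| < `|z - r|.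
Proof.
move=> zr; have R1 : 'Re (1 : algC) = 1 by apply/Creal_ReP; rewrite rpred1.
have I1 : 'Im (1 : algC) = 0 by apply/Creal_ImP; rewrite rpred1.
apply: norm_lt_Re; rewrite !raddfB !raddfD /= ?R1 ?I1 ?addr0 //.
rewrite -subr_gt0.
have -> : ('Re z - 'Re r) ^+ 2 - ('Re z + 1 - 'Re r) ^+ 2 = 2 * (('Re r - 2^-1) - 'Re z).
  by field.
by rewrite mulr_gt0 // subr_gt0.
Qed.

Lemma prod_norm_lt (I : eqType) (s : seq I) (F G : I -> algC) :
  (forall i, i \in s -> `|F i| < `|G i|) ->
  `|\prod_(i <- s) F i| <= `|\prod_(i <- s) G i| ?= iff (s == [::]).
Proof.
elim: s => [|i s IH] FG; first by rewrite !big_nil; split; rewrite ?eqxx.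
have Fi := FG i (mem_head _ _).
have [le _] : `|\prod_(i <- s) F i| <= `|\prod_(i <- s) G i| ?= iff (s == [::]).
  by apply: IH => j js; apply: FG; rewrite inE js orbT.
have Gs : 0 < `|\prod_(i <- s) G i|.
  rewrite normr_gt0 big_seq prodf_seq_neq0; apply/allP => j js; apply/implyP => _.
  by rewrite -normr_gt0 (le_lt_trans _ (FG j _)) // inE js orbT.
rewrite !big_cons !normrM.
have lt : `|F i| * `|\prod_(i <- s) F i| < `|G i| * `|\prod_(i <- s) G i|.
  by apply: le_lt_trans (ler_wpM2l _ le) _; rewrite ?ltr_pM2r.
by split; [exact: ltW | rewrite lt_eqF].
Qed.

Lemma line_factor c Q : roots_on_line c Q -> Q != 0 ->
  exists rs, [/\ Q = lead_coef Q *: \prod_(r <- rs) ('X - r%:P),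
                 forall r, r \in rs -> 'Re r = c & (rs == [::]) = (size Q <= 1)%N].
Proof.
move=> Ql Q0; have [rs QE] := closed_field_poly_normal Q; exists rs.
have lQ : lead_coef Q != 0 by rewrite lead_coef_eq0.
split=> // [r rrs|].
  by apply: Ql => //; rewrite QE rootZ // root_prod_XsubC.
by rewrite QE size_scale // size_prod_XsubC ltnS leqn0 size_eq0.
Qed.

(** To the right of the line Re z = c - 1/2, the point z is nearer than z + 1 to every
root, so that the values at the two points can agree in modulus only for a
constant. *)
Lemma line_shift_right c Q z : roots_on_line c Q -> Q != 0 -> c - 2^-1 < 'Re z ->
  `|Q.[z]| <= `|Q.[z + 1]| ?= iff (size Q <= 1)%N.
Proof.
move=> Ql Q0 zc; have [rs [QE rsc <-]] := line_factor Ql Q0.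
have l0 : `|lead_coef Q| != 0 by rewrite normr_eq0 lead_coef_eq0.
have [le eq] : `|\prod_(r <- rs) (z - r)| <= `|\prod_(r <- rs) (z + 1 - r)|
    ?= iff (rs == [::]).
  by apply: prod_norm_lt => r rrs; apply: norm_shift_right; rewrite (rsc _ rrs).
have hE x : (\prod_(r <- rs) ('X - r%:P)).[x] = \prod_(r <- rs) (x - r).
  by rewrite horner_prod; apply: eq_bigr => r _; rewrite hornerXsubC.
rewrite QE !hornerZ !normrM !hE.
by split; [exact: ler_wpM2l | rewrite (inj_eq (mulfI l0))].
Qed.

Lemma line_shift_left c Q z : roots_on_line c Q -> Q != 0 -> 'Re z < c - 2^-1 ->
  `|Q.[z + 1]| <= `|Q.[z]| ?= iff (size Q <= 1)%N.
Proof.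
move=> Ql Q0 zc; have [rs [QE rsc <-]] := line_factor Ql Q0.
have l0 : `|lead_coef Q| != 0 by rewrite normr_eq0 lead_coef_eq0.
have [le eq] : `|\prod_(r <- rs) (z + 1 - r)| <= `|\prod_(r <- rs) (z - r)|
    ?= iff (rs == [::]).
  by apply: prod_norm_lt => r rrs; apply: norm_shift_left; rewrite (rsc _ rrs).
have hE x : (\prod_(r <- rs) ('X - r%:P)).[x] = \prod_(r <- rs) (x - r).
  by rewrite horner_prod; apply: eq_bigr => r _; rewrite hornerXsubC.
rewrite QE !hornerZ !normrM !hE.
by split; [exact: ler_wpM2l | rewrite (inj_eq (mulfI l0))].
Qed.

Definition lstep w f := f \Po ('X + 1) - w *: f.

Lemma lstepE w f z : (lstep w f).[z] = f.[z + 1] - w * f.[z].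
Proof. by rewrite /lstep !hornerE horner_comp !hornerE. Qed.

(** At a root of the new polynomial, the values of [Q] at z and z + 1 have the same
modulus. *)
Lemma lstep_line c w Q : c \is Num.real -> `|w| = 1 ->
  roots_on_line c Q -> roots_on_line (c - 2^-1) (lstep w Q).
Proof.
move=> cR w1 Ql z S0 /rootP; rewrite lstepE => /eqP; rewrite subr_eq0 => /eqP Ez.
have Q0 : Q != 0 by apply: contraNneq S0 => ->; rewrite /lstep comp_poly0 scaler0 subr0.
have nE : `|Q.[z + 1]| = `|Q.[z]| by rewrite Ez normrM w1 mul1r.
have const : (size Q <= 1)%N -> False.
  move=> /size1_polyC QC; move: S0 Ez; rewrite QC /lstep comp_polyC !hornerC.
  rewrite -mul_polyC -polyCM -polyCB polyC_eq0 => /eqP S0 Ez.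
  by apply: S0; apply/eqP; rewrite subr_eq0; apply/eqP.
have c2R : c - 2^-1 \is Num.real by rewrite rpredB // rpredV realn.
have [lt|lt|//] := real_ltgtP (Creal_Re z) c2R.
  have [_] := line_shift_left Ql Q0 lt; rewrite nE eqxx => /esym/const[].
have [_] := line_shift_right Ql Q0 lt; rewrite nE eqxx => /esym/const[].
Qed.

Definition ffC (k : nat) : {poly algC} := \prod_(i < k) ('X - i%:R%:P).

Lemma ffC_recr k : ffC k.+1 = ffC k * ('X - k%:R%:P).
Proof. by rewrite /ffC big_ord_recr. Qed.

Lemma ffC_shift k : ffC k.+1 \Po ('X + 1) = ('X + 1) * ffC k.
Proof.
rewrite /ffC big_ord_recl rmorphM /= rmorph_prod /=.
rewrite comp_polyB comp_polyX comp_polyC polyC0 subr0; congr (_ * _).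
apply: eq_bigr => i _; rewrite comp_polyB comp_polyX comp_polyC.
by rewrite -[bump 0 i]/(i.+1) -natr1 polyCD opprD addrACA subrr addr0.
Qed.

(** The quotient of [lstep w (ffC k.+1 * Q)] by [ffC k], see [lstep_ffC]. *)
Definition lquot w k Q :=
  ('X + 1) * (Q \Po ('X + 1)) - w *: (('X - k%:R%:P) * Q).

Lemma lstep_ffC w k Q : lstep w (ffC k.+1 * Q) = ffC k * lquot w k Q.
Proof.
rewrite /lstep /lquot comp_polyM ffC_shift ffC_recr [RHS]mulrBr -scalerAr.
by congr (_ - _ *: _); ring.
Qed.

(** The equation is (z + 1) Q(z + 1) = w (z - k) Q(z). The points z + 1 and z - k have
the same modulus on the line Re z = (k - 1)/2, which is also where the values of
[Q] at z + 1 and z have the same modulus; off this line both inequalities go in the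
same direction. *)
Lemma lquot_line w k Q : `|w| = 1 -> roots_on_line (k%:R / 2) Q ->
  roots_on_line (k%:R / 2 - 2^-1) (lquot w k Q).
Proof.
move=> w1 Ql z S0 /rootP; rewrite /lquot !hornerE horner_comp !hornerE => /eqP.
rewrite subr_eq0 => /eqP Ez.
have Q0 : Q != 0.
  by apply: contraNneq S0 => ->; rewrite /lquot comp_poly0 !mulr0 scaler0 subr0.
have nE : `|z + 1| * `|Q.[z + 1]| = `|z - k%:R| * `|Q.[z]|.
  by rewrite -[LHS]normrM Ez !normrM w1 mul1r.
have kR : (k%:R / 2 - 2^-1 : algC) \is Num.real.
  by rewrite rpredB ?rpredM ?rpredV ?realn.
have R1 : 'Re (1 : algC) = 1 by apply/Creal_ReP; rewrite rpred1.
have I1 : 'Im (1 : algC) = 0 by apply/Creal_ImP; rewrite rpred1.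
have Rk : 'Re (k%:R : algC) = k%:R by apply/Creal_ReP; rewrite realn.
have Ik : 'Im (k%:R : algC) = 0 by apply/Creal_ImP; rewrite realn.
have sq : ('Re z + 1) ^+ 2 - ('Re z - k%:R) ^+ 2 =
          2 * (k%:R + 1) * ('Re z - (k%:R / 2 - 2^-1)).
  by field.
have k1 : 0 < 2 * (k%:R + 1) :> algC by rewrite mulr_gt0 // natr1.
have [lt|lt|//] := real_ltgtP (Creal_Re z) kR.
  have [le _] := line_shift_left Ql Q0 lt.
  have n0 : 0 < `|Q.[z]|.
    rewrite normr_gt0; apply: contraTneq lt => /rootP/(Ql _ Q0) ->.
    by rewrite -real_leNgt ?lerBlDr ?lerDl ?invr_ge0 // rpredM ?rpredV ?realn.
  have zk : `|z + 1| < `|z - k%:R|.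
    apply: norm_lt_Re; rewrite !(raddfB, raddfD) /= ?R1 ?I1 ?Rk ?Ik ?addr0 ?subr0 //.
    by rewrite -subr_lt0 sq pmulr_rlt0 // subr_lt0.
  have : `|z + 1| * `|Q.[z + 1]| < `|z - k%:R| * `|Q.[z]|.
    by apply: le_lt_trans (ler_wpM2l _ le) _; rewrite // ltr_pM2r.
  by rewrite nE ltxx.
have [le _] := line_shift_right Ql Q0 lt.
have n0 : 0 < `|Q.[z + 1]|.
  rewrite normr_gt0; apply: contraTneq lt => /rootP/(Ql _ Q0).
  rewrite raddfD /= R1 => kE; rewrite -kE.
  have -> : 'Re z + 1 - 2^-1 = 'Re z + 2^-1 by field.
  by rewrite -real_leNgt ?lerDl ?invr_ge0 // ?Creal_Re // rpredD ?Creal_Re ?rpredV ?realn.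
have zk : `|z - k%:R| < `|z + 1|.
  apply: norm_lt_Re; rewrite !(raddfB, raddfD) /= ?R1 ?I1 ?Rk ?Ik ?addr0 ?subr0 //.
  by rewrite -subr_gt0 sq pmulr_rgt0 // subr_gt0.
have : `|z - k%:R| * `|Q.[z]| < `|z + 1| * `|Q.[z + 1]|.
  by apply: le_lt_trans (ler_wpM2l _ le) _; rewrite // ltr_pM2r.
by rewrite -nE ltxx.
Qed.

Definition lsteps ws f := foldr lstep f ws.

Definition unitary ws := forall w, w \in ws -> `|w| = 1.

Lemma lsteps_line ws c Q : c \is Num.real -> unitary ws -> roots_on_line c Q ->
  roots_on_line (c - (size ws)%:R / 2) (lsteps ws Q).
Proof.
move=> cR; elim: ws => [|w ws IH] u Ql; first by rewrite mul0r subr0.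
rewrite /= [_ - _](_ : _ = c - (size ws)%:R / 2 - 2^-1); last by rewrite -natr1; field.
apply: lstep_line; first by rewrite rpredB // rpredM ?rpredV ?realn.
  by apply: u; rewrite mem_head.
by apply: IH => // w' ww'; apply: u; rewrite inE ww' orbT.
Qed.

Lemma lsteps_ffC ws k Q : unitary ws -> (size ws <= k)%N ->
  roots_on_line (k%:R / 2 - 2^-1) Q ->
  exists2 Q', lsteps ws (ffC k * Q) = ffC (k - size ws) * Q' &
              roots_on_line ((k - size ws)%:R / 2 - 2^-1) Q'.
Proof.
elim: ws => [|w ws IH] u szk Ql; first by exists Q; rewrite ?subn0.
have [] := IH _ (ltnW szk) Ql; first by move=> w' ww'; apply: u; rewrite inE ww' orbT.
move=> Q' E Q'l; exists (lquot w (k - size (w :: ws)) Q').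
  by rewrite /= -/(lsteps ws _) E -lstep_ffC subnS prednK // subn_gt0.
apply: lquot_line; first by apply: u; rewrite mem_head.
rewrite [_ / 2](_ : _ = (k - size ws)%:R / 2 - 2^-1) //.
rewrite /= subnS; have : (0 < k - size ws)%N by rewrite subn_gt0.
by case: (_ - _)%N => // m _; rewrite /= -natr1; field.
Qed.

(** * Polynomials in the shift *)

(** The polynomial [p] evaluated at the shift f(X) -> f(X + 1), applied to [f]. Its
factorisation into linear factors becomes a composite of [lstep]. *)
Definition opoly (p : {poly algC}) f : {poly algC} :=
  \sum_(i < size p) p`_i *: (f \Po ('X + i%:R%:P)).

Lemma opoly_wide n p f : (size p <= n)%N ->
  opoly p f = \sum_(i < n) p`_i *: (f \Po ('X + i%:R%:P)).
Proof.
move=> pn; rewrite /opoly (big_ord_widen n (fun i => p`_i *: (f \Po ('X + i%:R%:P)))) //.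
rewrite big_mkcond /=; apply: eq_bigr => i _.
by case: ltnP => // /(nth_default 0) ->; rewrite scale0r.
Qed.

Lemma opoly1 f : opoly 1 f = f.
Proof.
by rewrite /opoly size_poly1 big_ord1 coef1 scale1r addr0 comp_polyXr.
Qed.

Lemma opoly_factor w p f : opoly (('X - w%:P) * p) f = lstep w (opoly p f).
Proof.
have sz : (size (('X - w%:P) * p)%R <= (size p).+1)%N.
  by apply: leq_trans (size_polyMleq _ _) _; rewrite size_XsubC.
rewrite (opoly_wide _ sz) /lstep [X in _ - _ *: X](opoly_wide f (leqnSn _)).
rewrite scaler_sumr.
under eq_bigr => i _ do rewrite mulrBl coefB coefCM scalerBl -scalerA.
rewrite sumrB; congr (_ - _).
rewrite big_ord_recl coefXM scale0r add0r /opoly raddf_sum /=.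
apply: eq_bigr => i _; rewrite coefXM /= comp_polyZ -comp_polyA; congr (_ *: (_ \Po _)).
by rewrite comp_polyD comp_polyX comp_polyC -addrA -polyCD -[bump 0 i]/(i.+1) -nat1r.
Qed.

Lemma opoly_prod ws f : opoly (\prod_(w <- ws) ('X - w%:P)) f = lsteps ws f.
Proof.
elim: ws => [|w ws IH]; first by rewrite big_nil opoly1.
by rewrite big_cons opoly_factor IH.
Qed.

Lemma monic_unit_roots (p : {poly algC}) m : p \is monic -> size p = m.+1 ->
  (forall z, root p z -> `|z| = 1) ->
  exists ws, [/\ p = \prod_(w <- ws) ('X - w%:P), size ws = m & unitary ws].
Proof.
move=> /eqP mp sp rp; have [ws] := closed_field_poly_normal p.
rewrite mp scale1r => pE; exists ws; split=> //.
  by move: sp; rewrite pE size_prod_XsubC => -[].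
by move=> w ww; apply: rp; rewrite pE root_prod_XsubC.
Qed.

Lemma norm_root_unity (z : algC) (r : nat) : (0 < r)%N -> z ^+ r = 1 -> `|z| = 1.
Proof.
move=> r0 zr; apply/eqP; rewrite -(pexpr_eq1 r0) // -normrX zr.
by rewrite normr1.
Qed.

Lemma roots_Xn_sub_1 (r : nat) : (0 < r)%N ->
  exists ws, [/\ 'X^r - 1 = \prod_(w <- ws) ('X - w%:P), size ws = r & unitary ws].
Proof.
move=> r0; apply: monic_unit_roots; first exact: monicXnsubC.
  exact: size_XnsubC.
move=> z /rootP; rewrite !hornerE => /eqP; rewrite subr_eq0 => /eqP.
exact: norm_root_unity.
Qed.

Lemma roots_geometric (r : nat) :
  exists ws, [/\ \sum_(j < r.+1) 'X^j = \prod_(w <- ws) ('X - w%:P), size ws = r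
               & unitary ws].
Proof.
set p := \sum_(j < r.+1) 'X^j.
have E : 'X^(r.+1) - 1 = ('X - 1%:P) * p :> {poly algC}.
  rewrite -{1}(expr1n _ r.+1) subrXX; congr (_ * _); rewrite /p.
  rewrite (reindex_inj rev_ord_inj) /=; apply: eq_bigr => j _.
  by rewrite expr1n mulr1 subSS subKn // -ltnS.
have p0 : p != 0.
  apply/eqP => p0; have := congr1 (size : {poly algC} -> nat) E.
  by rewrite p0 mulr0 size_poly0 size_XnsubC.
apply: monic_unit_roots.
- have : 'X^(r.+1) - 1%:P \is @monic algC by apply: monicXnsubC.
  by rewrite polyC1 E monicMl // monicXsubC.
- have : size ('X^(r.+1) - 1 : {poly algC}) = r.+2 by rewrite -polyC1 size_XnsubC.
  by rewrite E mulrC size_Mmonic ?monicXsubC // size_XsubC addn2 => -[].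
move=> z /rootP pz; apply: (@norm_root_unity z r.+1) => //; apply/eqP; rewrite -subr_eq0.
by have := congr1 (horner^~ z) E; rewrite hornerM pz mulr0 !hornerE => ->.
Qed.

Local Notation pC := (map_poly (ratr : rat -> algC)).

Lemma pC_shift (W : {poly rat}) (x : rat) :
  pC (W \Po ('X + x%:P)) = pC W \Po ('X + (ratr x)%:P).
Proof. by rewrite map_comp_poly rmorphD /= map_polyX map_polyC. Qed.

Lemma opoly_Xn_sub_1 (r : nat) f : (0 < r)%N ->
  opoly ('X^r - 1) f = f \Po ('X + r%:R%:P) - f.
Proof.
move=> r0; rewrite (opoly_wide f (n := r.+1)); last by rewrite -polyC1 size_XnsubC.
under eq_bigr => i _ do rewrite coefB coefXn coef1 scalerBl.
rewrite sumrB (bigD1 ord_max) //= eqxx scale1r big1 ?addr0; last first.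
  by move=> i /negPf; rewrite -val_eqE /= => ->; rewrite scale0r.
congr (_ - _); rewrite (bigD1 ord0) //= scale1r big1 ?addr0; last first.
  by move=> i /negPf; rewrite -val_eqE /= => ->; rewrite scale0r.
by rewrite comp_polyXr.
Qed.

Lemma sdiffs_lsteps mu : all (leq 1) mu ->
  exists ws, [/\ size ws = sumn mu, unitary ws &
                 forall W : {poly rat}, pC (sdiffs mu W) = lsteps ws (pC W)].
Proof.
elim: mu => [|r mu IH]; first by exists [::].
move=> /= /andP[r0 /IH[ws1 [sz1 u1 E1]]].
have [ws2 [P2 sz2 u2]] := roots_Xn_sub_1 r0; exists (ws1 ++ ws2); split.
- by rewrite size_cat sz1 sz2 addnC.
- by move=> w; rewrite mem_cat => /orP[/u1|/u2].
move=> W; rewrite /lsteps foldr_cat -!/(lsteps _ _) -(opoly_prod ws2) -P2 opoly_Xn_sub_1 //.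
by rewrite -[r%:R](ratr_nat algC) -pC_shift -rmorphB -E1.
Qed.

Lemma pC_ffpoly k : pC (ffpoly k) = ffC k.
Proof.
rewrite /ffpoly rmorph_prod; apply: eq_bigr => i _.
by rewrite rmorphB /= map_polyX map_polyC /= ratr_nat.
Qed.

Lemma line_shift c (k : nat) Q : roots_on_line c Q ->
  roots_on_line (c + k%:R) (Q \Po ('X - k%:R%:P)).
Proof.
move=> Ql z S0 /rootP; rewrite horner_comp !hornerE => /rootP Qz.
have Q0 : Q != 0 by apply: contraNneq S0 => ->; rewrite comp_poly0.
have Rk : 'Re (k%:R : algC) = k%:R by apply/Creal_ReP; rewrite realn.
by rewrite -(Ql _ Q0 Qz) raddfB /= Rk subrK.
Qed.

Lemma opoly_geometric a f :
  opoly (\sum_(j < a) 'X^j) f = \sum_(j < a) (f \Po ('X + j%:R%:P)).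
Proof.
have cf i : (i < a)%N -> (\sum_(j < a) 'X^j : {poly algC})`_i = 1.
  move=> ia; rewrite coef_sum (bigD1 (Ordinal ia)) //= coefXn eqxx big1 ?addr0 // => j.
  by rewrite -val_eqE /= eq_sym coefXn => /negPf ->.
rewrite (opoly_wide f (n := a)).
  by apply: eq_bigr => j _; rewrite cf // scale1r.
by apply: (leq_trans (size_sum _ _ _)); apply/bigmax_leqP => j _; rewrite size_polyXn.
Qed.

(** The sumn mu = a + b steps of [sdiffs] are applied to (X)_b: the first b of them use
up the falling factorial and end with roots on Re z = -1/2, the remaining a move
them to Re z = -1/2 - a/2. After the translation by a they lie on
Re z = (a - 1)/2, the line that fits the new factor (X)_a. The a - 1 steps of the
geometric sum then lead to X Q' with the roots of Q' on Re z = 0. *)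
Theorem connpoly_line a b mu : (0 < a)%N -> all (leq 1) mu -> sumn mu = (a + b)%N ->
  roots_on_line 0 (pC (connpoly a b mu)).
Proof.
case: a => // a _ mu1 smu.
have [ws [szw uw wE]] := sdiffs_lsteps mu1.
pose W := pC (sdiffs mu (ffpoly b)); pose Q := W \Po ('X - a.+1%:R%:P).
have u1 : unitary (take a.+1 ws) by move=> w /mem_take; exact: uw.
have u2 : unitary (drop a.+1 ws) by move=> w /mem_drop; exact: uw.
have sz1 : size (take a.+1 ws) = a.+1 by rewrite size_takel // szw smu leq_addr.
have sz2 : size (drop a.+1 ws) = b by rewrite size_drop szw smu addKn.
have half : (2^-1 : algC) \is Num.real by rewrite rpredV realn.
have Wl : roots_on_line (- 2^-1 - a.+1%:R / 2) W.
  rewrite /W wE pC_ffpoly -(cat_take_drop a.+1 ws) /lsteps foldr_cat -!/(lsteps _ _).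
  have one_line : roots_on_line (b%:R / 2 - 2^-1) 1.
    by move=> z _ r1; case/negP: (root1 z).
  have := lsteps_ffC u2 _ one_line; rewrite sz2 subnn mulr1 => -[//|Q' -> Q'l].
  rewrite /ffC big_ord0 mul1r -[in a.+1%:R / 2]sz1; apply: lsteps_line => //.
    by rewrite rpredN.
  by rewrite mul0r sub0r in Q'l.
have Ql : roots_on_line (a.+1%:R / 2 - 2^-1) Q.
  rewrite [_ - _](_ : _ = - 2^-1 - a.+1%:R / 2 + a.+1%:R); last by field.
  exact: line_shift.
have -> : pC (connpoly a.+1 b mu) = opoly (\sum_(j < a.+1) 'X^j) (ffC a.+1 * Q).
  rewrite opoly_geometric /connpoly rmorph_sum; apply: eq_bigr => j _.
  rewrite rmorphM /= pC_shift ratr_nat pC_ffpoly comp_polyM mulrC; congr (_ * _).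
  rewrite -addrA -polyCN -polyCD pC_shift /Q -comp_polyA; congr (_ \Po _).
  rewrite comp_polyB comp_polyX comp_polyC rmorphD rmorphN /= !ratr_nat polyCD polyCN.
  by rewrite -addrA [- _ + _]addrC addrA.
have [vs [-> szv uv]] := roots_geometric a.
rewrite opoly_prod; have := lsteps_ffC uv _ Ql; rewrite szv => -[//|Q' -> Q'l].
rewrite subSnn mul1r subrr in Q'l *.
rewrite /ffC big_ord1 subr0 => z; rewrite mulf_eq0 negb_or => /andP[_ Q'0].
rewrite rootM => /orP[|/(Q'l z Q'0)//].
by rewrite rootX => /eqP ->; rewrite raddf0.
Qed.

(** * Total positivity of order two *)

Definition tp2 (R : numDomainType) (s : nat -> R) :=
  forall i j, (i <= j)%N -> s i * s j.+1 <= s i.+1 * s j.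

(** Multiplication by X + t with t >= 0 turns the minors of the coefficient sequence
into combinations, with nonnegative weights, of minors and of products of two
coefficients of the given sequence. *)
Lemma tp2_prod (R : numDomainType) (ts : seq R) : (forall t, t \in ts -> 0 <= t) ->
  tp2 (fun i => (\prod_(t <- ts) ('X + t%:P))`_i) /\
  forall i, 0 <= (\prod_(t <- ts) ('X + t%:P))`_i.
Proof.
elim: ts => [|t ts IH] ts0.
  rewrite big_nil; split=> [i j ij|i]; rewrite !coef1; last by rewrite ler0n.
  by rewrite mulr0 mul0r.
rewrite big_cons; set p := \prod_(t <- ts) _ in IH *.
have [|ptp p0] := IH; first by move=> t' tt'; apply: ts0; rewrite inE tt' orbT.
have t0 : 0 <= t by apply: ts0; rewrite mem_head.
have c0 : (('X + t%:P) * p)`_0 = t * p`_0 by rewrite mulrDl coefD coefXM coefCM add0r.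
have cS i : (('X + t%:P) * p)`_i.+1 = p`_i + t * p`_i.+1.
  by rewrite mulrDl coefD coefXM coefCM.
split; last by case=> [|i]; rewrite ?c0 ?cS ?addr_ge0 ?mulr_ge0.
move=> [|i] [|j] // ij; rewrite ?c0 !cS -subr_ge0.
- rewrite [X in 0 <= X](_ : _ = 0) //; ring.
- rewrite [X in 0 <= X](_ : _ = p`_0 * p`_j + t * (p`_1 * p`_j)
     + t * t * (p`_1 * p`_j.+1 - p`_0 * p`_j.+2)); last by ring.
  have h : 0 <= p`_1 * p`_j.+1 - p`_0 * p`_j.+2 by rewrite subr_ge0; apply: (ptp 0%N j.+1).
  by apply: addr_ge0 (addr_ge0 _ _) (mulr_ge0 _ h); rewrite ?mulr_ge0.
rewrite ltnS leq_eqVlt in ij; case/orP: ij => [/eqP ->|ij].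
  by rewrite [X in 0 <= X](_ : _ = 0) //; ring.
rewrite [X in 0 <= X](_ : _ = (p`_i.+1 * p`_j - p`_i * p`_j.+1)
   + t * (p`_i.+2 * p`_j - p`_i * p`_j.+2)
   + t * t * (p`_i.+2 * p`_j.+1 - p`_i.+1 * p`_j.+2)); last by ring.
have h1 : p`_i * p`_j.+1 <= p`_i.+1 * p`_j by apply: ptp; exact: ltnW.
have h2 : p`_i * p`_j.+2 <= p`_i.+1 * p`_j.+1 by apply: ptp; rewrite ltnW // ltnS ltnW.
have h3 : p`_i.+1 * p`_j.+1 <= p`_i.+2 * p`_j by apply: ptp.
have h4 : p`_i.+1 * p`_j.+2 <= p`_i.+2 * p`_j.+1 by apply: ptp; rewrite ltnS ltnW.
rewrite -subr_ge0 in h1; rewrite -subr_ge0 in h4.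
have h23 : 0 <= p`_i.+2 * p`_j - p`_i * p`_j.+2 by rewrite subr_ge0 (le_trans h2).
by apply: addr_ge0 (addr_ge0 h1 (mulr_ge0 t0 h23)) (mulr_ge0 _ h4); rewrite mulr_ge0.
Qed.

Lemma imaginary_square z : 'Re z = 0 -> 0 <= - z ^+ 2.
Proof.
move=> z0; rewrite [z]Crect z0 add0r exprMn sqrCi mulN1r opprK.
by rewrite real_exprn_even_ge0 // Creal_Im.
Qed.

(** By parity P = X^e D(X^2), so that the roots of D are squares of purely imaginary
numbers, and D is a real constant times a product of factors X + t with t >= 0.
The square of the constant does not affect the minors. *)
Theorem tp2_of_imaginary_roots (P : {poly rat}) (e : bool) :
  (forall i, odd i != e -> P`_i = 0) -> roots_on_line 0 (pC P) ->
  tp2 (fun j => P`_(j.*2 + e)).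
Proof.
move=> Pe Pl; pose D := \poly_(j < size P) ratr P`_(j.*2 + e) : {poly algC}.
have DE j : D`_j = ratr P`_(j.*2 + e).
  rewrite coef_poly; case: ltnP => // Pj; rewrite nth_default ?rmorph0 //.
  by apply: leq_trans Pj _; rewrite -addnn -addnA leq_addr.
have PE : pC P = 'X^e * (D \Po 'X^2).
  apply/polyP => i; rewrite coef_map coefXnM /=; case: ltnP => [ie|ei].
    have oe : odd i != e by move: ie; case: (e) => //; case: (i).
    by rewrite Pe ?rmorph0.
  rewrite coef_comp_poly_Xn // DE dvdn2 divn2.
  have -> : odd (i - e) = (odd i != e) by rewrite oddB //; case: (odd i); case: (e).
  case: eqVneq => [oe|ne] /=; last by rewrite Pe ?rmorph0.
  congr (ratr P`_ _); rewrite -[LHS](subnK ei); congr (_ + _)%N.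
  by rewrite -[LHS]odd_double_half oddB // oe; case: (e).
have [D0|D0] := eqVneq D 0.
  by move=> i j ij; rewrite -(ler_rat algC) !rmorphM /= -!DE D0 !coef0.
have P0 : pC P != 0.
  rewrite PE mulf_neq0 ?expf_neq0 ?polyX_eq0 //.
  apply: contraNneq D0 => DX; apply/eqP/polyP => j; rewrite coef0.
  have := congr1 (fun p : {poly algC} => p`_(j * 2)) DX.
  by rewrite coef_comp_poly_Xn // dvdn_mull // mulnK // coef0.
have [rs Drs] := closed_field_poly_normal D.
have lead_real : lead_coef D \is Num.real.
  by rewrite lead_coefE DE Creal_Crat // Crat_rat.
have rs0 r : r \in rs -> 0 <= - r.
  move=> rrs; have Dr : root D r.
    by rewrite Drs rootZ ?lead_coef_eq0 // root_prod_XsubC.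
  rewrite -(sqrtCK r); apply: imaginary_square; apply: Pl => //.
  by rewrite PE rootM; apply/orP; right; rewrite /root horner_comp hornerXn sqrtCK.
have [|tp _] := @tp2_prod algC [seq - r | r <- rs].
  by move=> t /mapP[r rrs ->]; exact: rs0.
have prodE : \prod_(t <- [seq - r | r <- rs]) ('X + t%:P) = \prod_(r <- rs) ('X - r%:P).
  by rewrite big_map; apply: eq_bigr => r _; rewrite polyCN.
rewrite prodE in tp; move=> i j ij.
rewrite -(ler_rat algC) !rmorphM /= -!DE Drs !coefZ !(mulrACA (lead_coef D) _ (lead_coef D)).
rewrite ler_wpM2l ?tp // -expr2 real_exprn_even_ge0 //.
Qed.

End Roots.

Lemma log_concave_of_tp2 (R : realDomainType) (s : nat -> nat) :
  (forall g h, (g <= h)%N -> (s g * s h.+1 <= s g.+1 * s h)%N) ->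
  log_concave (fun g => (s g)%:R : R).
Proof.
move=> tp [|i] // _; rewrite -natrM -natrX ler_nat expnS expn1.
exact: tp (leqnSn i).
Qed.

(** Log-concavity would allow internal zeros; comparing with the position k of a
maximum needs the inequalities for g and h that are far apart. They say that
s h.+1 / s h is at most s g.+1 / s g, which has to be at least 1 on the left of k
and at most 1 on its right. *)
Lemma unimodal_of_tp2 (R : realDomainType) (s : nat -> nat) (m : nat) :
  (forall g h, (g <= h)%N -> (s g * s h.+1 <= s g.+1 * s h)%N) ->
  (forall g, (m < g)%N -> s g = 0%N) ->
  unimodal (fun g => (s g)%:R : R).
Proof.
move=> tp s0; pose k := [arg max_(i > @ord0 m) s i].
have kmax g : (s g <= s k)%N.
  have [gm|/s0 -> //] := leqP g m; rewrite /k; case: arg_maxnP => // i _ imax.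
  by have := imax (inord g) isT; rewrite inordK.
exists k; split=> g gk; rewrite ler_nat.
  have := tp g k.-1; rewrite prednK; last exact: leq_ltn_trans gk.
  have -> : (g <= k.-1)%N by rewrite -ltnS prednK // (leq_ltn_trans _ gk).
  move=> /(_ isT) le; have := leq_trans le (leq_mul (leqnn (s g.+1)) (kmax k.-1)).
  have [k0|k0] := posnP (s k); last by rewrite leq_pmul2r.
  by move=> _; apply: leq_trans (kmax g) _; rewrite k0.
have := leq_trans (tp _ _ gk) (leq_mul (kmax k.+1) (leqnn (s g))).
have [k0|k0] := posnP (s k); last by rewrite leq_pmul2l.
by move=> _; apply: leq_trans (kmax g.+1) _; rewrite k0.
Qed.

(** * Permutations as products of disjoint cycles *)

Section CycleShape.
Variable T : finType.
Implicit Types (s : {perm T}) (x z : T).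

Lemma cycE (l : seq T) z : uniq l -> z \in l -> cyc l z = next l z.
Proof.
move=> U zl; have [i l' rE] := rot_to zl.
have Ur : uniq (z :: l') by rewrite -rE rot_uniq.
have -> : cyc l = cyc (z :: l').
  by rewrite -rE /rot -cyc_rot cat_take_drop.
rewrite -(next_rot i U) rE; case: l' Ur {rE} => [|y l'] Ur; first by rewrite /= perm1 eqxx.
by rewrite cyc_next //= eqxx.
Qed.

Lemma mem_orbit_porbit s x z : (z \in fingraph.orbit s x) = (z \in porbit s x).
Proof.
rewrite -fconnect_orbit; apply/idP/porbitP => [|[i ->]].
  by move/iter_findex => <-; exists (findex s x z); rewrite permX.
by rewrite permX fconnect_iter.
Qed.

Lemma partition_porbits s : partition (porbits s) [set: T].
Proof.
have -> : porbits s = [set action.orbit 'P <[s]> x | x in [set: T]]%g.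
  by apply/setP => C; apply/imsetP/imsetP => -[x _ ->]; exists x; rewrite ?inE ?porbitE.
by apply: orbit_partition; apply/actsP => u _ x; rewrite !inE.
Qed.

Lemma mem_picks (A : eqType) (a : A) (l : seq A) :
  a \in l -> exists l', (a, l') \in picks l.
Proof.
elim: l => // b l IH; rewrite inE => /orP[/eqP->|/IH[l' al']].
  by exists l; rewrite mem_head.
by exists (b :: l'); rewrite inE; apply/orP; right; apply/mapP; exists (a, l').
Qed.

(** Each orbit is listed as the [fingraph] orbit of a chosen point, whose entries
follow one another under [s]. *)
Lemma shaped_porbits s : shaped [set: T] [seq #|C| | C : {set T} in porbits s] s.
Proof.
pose blk (C : {set T}) : seq T := if [pick x in C] is Some x then fingraph.orbit s x else [::].
pose bs := [seq blk C | C <- enum (porbits s)].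
have blkP C : C \in porbits s -> exists2 x, blk C = fingraph.orbit s x & C = porbit s x.
  case/imsetP => x _ CE; rewrite /blk; case: pickP => [y|/(_ x)]; last first.
    by rewrite CE porbit_id.
  by rewrite CE => yx; exists y => //; apply/eqP; rewrite eq_porbit_mem porbit_sym.
have blk_mem C : C \in porbits s -> blk C =i C.
  by move=> /blkP[x -> ->] z; exact: mem_orbit_porbit.
have blk_uniq C : C \in porbits s -> uniq (blk C).
  by move=> /blkP[x -> _]; exact: orbit_uniq.
have blk_size C : C \in porbits s -> size (blk C) = #|C|.
  by move=> CP; rewrite -(eq_card (blk_mem C CP)); apply/esym/card_uniqP/blk_uniq.
have szE : map size bs = [seq #|C| | C : {set T} in porbits s].
  rewrite -map_comp; apply/eq_in_map => C; rewrite mem_enum.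
  exact: blk_size.
have bsT z : z \in flatten bs.
  apply/flattenP; exists (blk (porbit s z)); last by rewrite blk_mem ?imset_f // porbit_id.
  by apply: map_f; rewrite mem_enum imset_f.
have U : uniq (flatten bs).
  apply: (leq_size_uniq (enum_uniq T)) => [z _|]; first exact: bsT.
  rewrite -cardE size_flatten /shape szE sumnE big_image /=.
  by rewrite -(card_partition (partition_porbits s)) cardsT.
exists bs; split=> //.
- by move=> z; rewrite bsT inE.
- rewrite -szE; apply/allP => _ /mapP[_ /mapP[C CP ->] ->].
  by rewrite mem_enum in CP; case: (blkP C CP) => x -> _; rewrite size_orbit fingraph.order_gt0.
apply/permP => z; have /flattenP[b bb zb] := bsT z.
have [bs' pp] := mem_picks bb.
have PF := perm_flatten (picks_perm pp); rewrite /= in PF.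
rewrite (cycs_picks U pp) permM /=.
have [x bE] : exists x, b = fingraph.orbit s x.
  by case/mapP: bb => C; rewrite mem_enum => /blkP[x -> _] ->; exists x.
have -> : cyc b z = s z.
  rewrite cycE ?bE ?orbit_uniq -?bE //.
  have : fcycle s b by rewrite bE cycle_orbit //; exact: perm_inj.
  by move=> /next_cycle/(_ zb)/eqP.
rewrite cycs_out //; move: U; rewrite (perm_uniq PF) cat_uniq => /and3P[_ /hasPn dis _].
apply/negP => /dis; rewrite bE -fconnect_orbit => /negP; apply.
by apply: connect_trans (fconnect1 s z); rewrite fconnect_orbit -bE.
Qed.

End CycleShape.

(** * The maps that are not connected *)

Section DisjointProducts.
Variable T : finType.
Implicit Types (s t u : {perm T}) (x y z : T) (V : {set T}).

Lemma porbit_mono s V x y : (forall z, z \in V -> s z \in V) ->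
  x \in V -> y \in porbit s x -> y \in V.
Proof.
move=> sV xV /porbitP[i ->]; elim: i => [|i IH]; first by rewrite expg0 perm1.
by rewrite expgSr permM sV.
Qed.

Lemma eq_porbit_on s t V x : (forall z, z \in V -> s z \in V) ->
  {in V, s =1 t} -> x \in V -> porbit s x = porbit t x.
Proof.
move=> sV st xV; have E i : (s ^+ i)%g x = (t ^+ i)%g x /\ (s ^+ i)%g x \in V.
  elim: i => [|i [IH1 IH2]]; first by rewrite !expg0 perm1.
  by rewrite !expgSr !permM -IH1 -st // sV.
by apply/setP => y; apply/porbitP/porbitP => -[i ->]; exists i; have [] := E i.
Qed.

Lemma ncyc_split s V : (forall z, z \in V -> s z \in V) ->
  ncyc s = (#|porbit s @: V| + #|porbit s @: ~: V|)%N.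
Proof.
move=> sV; rewrite -cardsUI [X in (_ + X)%N](_ : _ = 0%N) ?addn0; last first.
  apply/eqP; rewrite cards_eq0; apply/set0Pn => -[C]; rewrite inE => /andP[].
  case/imsetP => x xV ->; case/imsetP => y; rewrite inE => /negP yV xy; apply: yV.
  by apply: (porbit_mono sV xV); rewrite xy porbit_id.
rewrite -imsetU setUCr /ncyc; congr #|pred_of_set _|.
by apply/setP => C; apply/imsetP/imsetP => -[x _ ->]; exists x; rewrite ?inE.
Qed.

Lemma card_porbits_fixed s V : {in V, forall x, s x = x} -> #|porbit s @: V| = #|V|.
Proof.
move=> sV; apply: card_in_imset => x y xV yV.
have p1 z : z \in V -> porbit s z = [set z].
  move=> zV; apply/setP => w; rewrite inE; apply/porbitP/eqP => [[i ->]|->].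
    by elim: i => [|i IH]; rewrite ?expg0 ?perm1 // expgSr permM IH sV.
  by exists 0%N; rewrite perm1.
by rewrite !p1 // => /set1_inj.
Qed.

(** Every point is a fixed point of one of the factors at least, which adds #|T| cycles
to those of the product. *)
Lemma ncyc_disjoint V s t : s \in Sym V -> t \in Sym (~: V) ->
  (ncyc (s * t)%g + #|T| = ncyc s + ncyc t)%N.
Proof.
move=> sV tV.
have s0 x : x \in ~: V -> s x = x by rewrite inE; exact: Sym_fix.
have t0 x : x \in V -> t x = x by move=> xV; apply: (Sym_fix tV); rewrite inE negbK.
have sclos x : x \in V -> s x \in V by move: sV; rewrite in_Sym => sV; rewrite perm_closed.
have tclos x : x \in ~: V -> t x \in ~: V.
  by move: tV; rewrite in_Sym => tV; rewrite perm_closed.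
have tclosV x : x \in V -> t x \in V by move=> xV; rewrite t0.
have stclos x : x \in V -> (s * t)%g x \in V by move=> xV; rewrite permM t0 ?sclos.
rewrite (ncyc_split sclos) (ncyc_split tclosV) (ncyc_split stclos).
rewrite (card_porbits_fixed s0) (card_porbits_fixed t0).
have -> : porbit (s * t)%g @: V = porbit s @: V.
  apply: eq_in_imset => x xV; apply: (eq_porbit_on stclos) => // z zV.
  by rewrite permM t0 // sclos.
have -> : porbit (s * t)%g @: (~: V) = porbit t @: (~: V).
  apply: eq_in_imset => x xV; apply: (@eq_porbit_on _ _ (~: V)) => // z zV.
    by rewrite permM s0 // tclos.
  by rewrite permM s0.
have := cardsC V; lia.
Qed.

Lemma imset_disjoint_mul V s t : s \in Sym V -> t \in Sym (~: V) -> (s * t)%g @: V = V.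
Proof.
move=> sV tV; have -> : (s * t)%g @: V = t @: (s @: V).
  by rewrite -imset_comp; apply: eq_imset => x; rewrite /= permM.
rewrite in_Sym in sV; rewrite (im_perm_on sV).
rewrite -[RHS]imset_id; apply: eq_in_imset => x xV.
by apply: (Sym_fix tV); rewrite inE negbK.
Qed.

(** A permutation that preserves V is the product of its restrictions to V and to the
complement. *)
Lemma big_stabiliser (R : nmodType) V (F : {perm T} -> R) :
  \sum_(u : {perm T} | u @: V == V) F u =
    \sum_(s in Sym V) \sum_(t in Sym (~: V)) F (s * t)%g.
Proof.
pose g u := (restr_perm V u, restr_perm (~: V) u).
have stab u : u @: V = V -> u \in 'N(V | 'P)%g /\ u \in 'N(~: V | 'P)%g.
  move=> uV; have uN : u \in 'N(V | 'P)%g.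
    by apply/astabsP => x; rewrite /= apermE -{1}uV mem_imset //; exact: perm_inj.
  by split=> //; apply/astabsP => x; rewrite !inE (astabsP uN).
have gE u : u @: V = V -> ((g u).1 * (g u).2)%g = u.
  move=> /stab[uV uV']; apply/permP => x; rewrite permM /=.
  have [xV|xV] := boolP (x \in V).
    have ux : u x \in V by have := astabsP uV x; rewrite /= apermE xV.
    by rewrite (restr_permE uV xV) (out_perm (restr_perm_on _ _)) // ?inE ?negbK.
  rewrite (out_perm (restr_perm_on V u) xV).
  by apply: restr_permE uV' _; rewrite inE.
rewrite pair_big /= (reindex_onto g (fun st => st.1 * st.2)%g) /=; last first.
  move=> [s t] /= /andP[sV tV].
  have stV := imset_disjoint_mul sV tV.
  have [stN stN'] := stab _ stV; congr (_, _); apply/permP => x.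
    have [xV|xV] := boolP (x \in V); last first.
      by rewrite (out_perm (restr_perm_on _ _)) // (Sym_fix sV).
    rewrite restr_permE // permM (Sym_fix tV) // inE negbK.
    by move: sV; rewrite in_Sym => sV; rewrite perm_closed.
  have [xV|xV] := boolP (x \in ~: V); last first.
    by rewrite (out_perm (restr_perm_on _ _)) // (Sym_fix tV).
  by rewrite restr_permE // permM (Sym_fix sV) //; rewrite inE in xV.
apply: eq_big => [u|u /eqP/gE /= ->] //.
rewrite !in_Sym !restr_perm_on /=; apply/eqP/eqP => [/gE //|<-].
by apply: imset_disjoint_mul; rewrite in_Sym restr_perm_on.
Qed.

End DisjointProducts.

Section DisconnectedSums.
Variables (T : finType) (N : nat).
Hypothesis N0 : (0 < N)%N.
Implicit Types (s t u a c : {perm T}) (x y z : T) (v w : seq T).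

Lemma exists_perm_map v w : uniq v -> uniq w -> v =i predT -> size v = size w ->
  exists u : {perm T}, map u v = w.
Proof.
move=> Uv Uw vT szvw; case: v Uv vT szvw => [|x0 v] Uv vT szvw.
  by exists 1%g; case: w {Uw} szvw.
pose f x := nth x0 w (index x (x0 :: v)).
have f_inj : injective f.
  move=> x y /eqP; rewrite nth_uniq ?Uw -?szvw ?index_mem ?vT // => /eqP E.
  by rewrite -(nth_index x0 (vT x)) E nth_index ?vT.
exists (perm f_inj); apply: (@eq_from_nth _ x0); first by rewrite size_map.
move=> i; rewrite size_map => iv; rewrite (nth_map x0) // permE /f index_uniq //.
Qed.

Lemma shaped_cycle v : v != [::] -> uniq v ->
  shaped [set z in v] [:: size v] (cyc v).
Proof.
move=> v0 Uv; exists [:: v]; split=> //=; rewrite ?cats0 //.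
- by move=> z; rewrite inE.
- by rewrite andbT lt0n size_eq0.
by rewrite /cycs big_seq1.
Qed.

(** The sum factors over the two cycles, and each factor is an instance of
[csum_pairing]. *)
Lemma csum_stabiliser v w : v != [::] -> w != [::] ->
  uniq (v ++ w) -> v ++ w =i predT ->
  \sum_(u : {perm T} | u @: [set z in v] == [set z in v])
     N%:R ^+ ncyc ((cyc v * cyc w) ^ u * (cyc v * cyc w)^-1)%g =
  pairing N [:: size v] [:: size v] * pairing N [:: size w] [:: size w].
Proof.
move=> v0 w0 U vwT; set V := [set z in v]; have VC : ~: V = [set z in w].
  apply/setP => z; rewrite !inE; have := vwT z; rewrite mem_cat inE.
  move: U; rewrite cat_uniq => /and3P[_ /hasPn dis _].
  case zw: (z \in w); first by rewrite (negPf (dis _ zw)).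
  by rewrite orbF => ->.
have /and3P[Uv _ Uw] : [&& uniq v, ~~ has (mem v) w & uniq w] by rewrite -cat_uniq.
have cv : cyc v \in Sym V by rewrite in_Sym cyc_on.
have cw : cyc w \in Sym (~: V) by rewrite in_Sym VC cyc_on.
have comm s t : s \in Sym V -> t \in Sym (~: V) -> commute s t.
  rewrite !in_Sym => sV tV; apply: perm_on_commute sV tV _ => x xV.
  by rewrite inE negbK.
have q0 : N%:R != 0 :> rat by rewrite pnatr_eq0 -lt0n.
apply: (mulIf (expf_neq0 #|T| q0)).
have -> : pairing N [:: size v] [:: size v] * pairing N [:: size w] [:: size w]
   * N%:R ^+ #|T| = csum N V (cyc v) (cyc v) * csum N (~: V) (cyc w) (cyc w).
  have sv := shaped_cycle v0 Uv; have sw := shaped_cycle w0 Uw; rewrite -VC in sw; rewrite -/V in sv.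
  rewrite (csum_pairing N0 sv sv) (csum_pairing N0 sw sw) mulrACA -exprD mulrC.
  by congr (N%:R ^+ _ * _); have := cardsC V; lia.
rewrite big_stabiliser mulr_suml [csum N V _ _]/csum mulr_suml; apply: eq_bigr => s sV.
rewrite mulr_suml [csum N _ _ _]/csum mulr_sumr; apply: eq_bigr => t tV.
have -> : ((cyc v * cyc w) ^ (s * t) * (cyc v * cyc w)^-1 =
           (cyc v ^ s * (cyc v)^-1) * (cyc w ^ t * (cyc w)^-1))%g.
  have fixc a c : commute a c -> (a ^ c = a)%g by move=> ac; rewrite conjgE ac mulKg.
  have cvs : (cyc v ^ s)%g \in Sym V by rewrite groupJ.
  rewrite conjMg !conjgM (fixc _ _ (comm _ _ cvs tV)).
  rewrite (fixc _ _ (commute_sym (comm _ _ sV cw))) invMg.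
  have cwt : (cyc w ^ t)%g \in Sym (~: V) by rewrite groupJ.
  move: (cyc v ^ s)%g (cyc w ^ t)%g cvs cwt => X Y XV YV.
  rewrite -!mulgA; congr (_ * _)%g; rewrite mulgA; apply: esym; apply: comm.
    by rewrite groupV.
  by rewrite groupM ?groupV.
rewrite -!exprD; congr (_ ^+ _); apply: (@ncyc_disjoint _ V).
  by rewrite groupM ?groupV ?groupJ.
by rewrite groupM ?groupV ?groupJ.
Qed.

(** The contribution of the [u] that carry the first cycle of one permutation onto
that of the other. Relabelling the points reduces it to [csum_stabiliser]. *)
Lemma csum_matching v1 v2 w1 w2 : v1 != [::] -> v2 != [::] ->
  uniq (v1 ++ v2) -> v1 ++ v2 =i predT -> uniq (w1 ++ w2) -> w1 ++ w2 =i predT ->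
  size w1 = size v1 ->
  \sum_(u : {perm T} | u @: [set z in w1] == [set z in v1])
     N%:R ^+ ncyc ((cyc w1 * cyc w2) ^ u * (cyc v1 * cyc v2)^-1)%g =
  pairing N [:: size v1] [:: size v1] * pairing N [:: size v2] [:: size v2].
Proof.
move=> v10 v20 Uv vT Uw wT sz1.
have sz : size (w1 ++ w2) = size (v1 ++ v2).
  by apply/perm_size/uniq_perm => // z; rewrite wT vT.
have [u0 u0E] := exists_perm_map Uw Uv wT sz.
have [E1 E2] : map u0 w1 = v1 /\ map u0 w2 = v2.
  move/eqP: u0E; rewrite map_cat eqseq_cat ?size_map // => /andP[/eqP ? /eqP ?].
  by split.
rewrite -(csum_stabiliser v10 v20 Uv vT) (reindex_inj (mulgI u0)) /=.
apply: eq_big => [u|u _]; last first.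
  by rewrite conjgM [((cyc w1 * cyc w2) ^ u0)%g]conjMg !cycJ E1 E2.
congr (_ == _); rewrite -E1; apply/setP => z; apply/imsetP/imsetP => -[x].
  rewrite inE => xw ->; exists (u0 x); rewrite ?permM // inE map_f //.
by rewrite inE => /mapP[y yw ->] ->; exists y; rewrite ?inE // permM.
Qed.

End DisconnectedSums.

(** * Transitivity for two cycles *)

Section Transitivity.
Variable T : finType.
Implicit Types (s t u a b c : {perm T}) (x y z : T) (v w : seq T).

(** Going around the cycle from [g], one never leaves O. *)
Lemma cyc_closed_sub w (O : {pred T}) g : uniq w -> g \in w -> g \in O ->
  (forall x, x \in w -> x \in O -> cyc w x \in O) -> {subset w <= O}.
Proof.
move=> Uw gw gO clos; have [w' [cE Pw Uw']] := cyc_to gw Uw.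
rewrite {}cE in clos; move=> z; rewrite (perm_mem Pw) => zw.
have {}clos x : x \in g :: w' -> x \in O -> cyc (g :: w') x \in O.
  by rewrite -(perm_mem Pw); exact: clos.
rewrite -(nth_index g zw); move: zw; rewrite -index_mem.
elim: (index z (g :: w')) => // i IH il; have il' := ltnW il.
set l := g :: w' in clos Uw' IH il il' *.
have -> : nth g l i.+1 = cyc l (nth g l i).
  have E : l = take i l ++ nth g l i :: nth g l i.+1 :: drop i.+2 l.
    by rewrite -!drop_nth ?cat_take_drop.
  rewrite {2}E cyc_rot -?E // cat_cons cyc_next //.
  by rewrite -!cat_cons -(perm_uniq (permEl (perm_catC _ _))) -E.
by apply: clos; [exact: mem_nth | exact: IH].
Qed.

Lemma two_cycles_on v w x : uniq (v ++ w) ->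
  (x \in v -> (cyc v * cyc w)%g x = cyc v x) /\
  (x \in w -> (cyc v * cyc w)%g x = cyc w x).
Proof.
rewrite cat_uniq => /and3P[_ /hasPn dis _]; rewrite permM; split=> [xv|xw].
  rewrite cyc_out //; have : cyc v x \in v.
    by have := perm_closed x (cyc_on v); rewrite !inE xv.
  by apply: contraL => /dis.
by rewrite [cyc v x]cyc_out //; exact: dis.
Qed.

Lemma cyc_mem v x : (cyc v x \in v) = (x \in v).
Proof. by have := perm_closed x (cyc_on v); rewrite !inE. Qed.

(** An orbit that meets a cycle of a * b contains it, so that the group is not
transitive exactly if each of the two cycles is an orbit; this is the case if a
preserves the first one. *)
Lemma transitive_two_cycles a b v w : (a * b)%g = (cyc v * cyc w)%g ->
  v != [::] -> w != [::] -> uniq (v ++ w) -> v ++ w =i predT ->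
  [transitive <<[set a; b]>>%g, on [set: T] | 'P] = ~~ all (fun x => a x \in v) v.
Proof.
move=> abE v0 w0 U vwT; set G := <<[set a; b]>>%g.
have aG : a \in G by rewrite mem_gen // !inE eqxx.
have bG : b \in G by rewrite mem_gen // !inE eqxx orbT.
have vw_dis x : x \in w -> x \notin v.
  by move: U; rewrite cat_uniq => /and3P[_ /hasPn dis _]; exact: dis.
have Uv : uniq v by move: U; rewrite cat_uniq => /and3P[].
have Uw : uniq w by move: U; rewrite cat_uniq => /and3P[].
have [x0 x0v] : exists x0, x0 \in v.
  by case: (v) v0 => // x l _; exists x; rewrite mem_head.
have [y0 y0w] : exists y0, y0 \in w.
  by case: (w) w0 => // x l _; exists x; rewrite mem_head.
pose V := [set x in v].
apply/idP/idP => [tr|/allPn[x1 x1v ax1]].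
  apply/negP => /allP aV.
  have aN : a \in 'N(V | 'P)%g.
    by rewrite !inE /=; apply/subsetP => x; rewrite !inE => /aV; rewrite apermE.
  have cN : (a * b)%g \in 'N(V | 'P)%g.
    rewrite abE !inE /=; apply/subsetP => x; rewrite !inE => xv; rewrite apermE.
    by have [/(_ xv) -> _] := two_cycles_on x U; rewrite cyc_mem.
  have bN : b \in 'N(V | 'P)%g by rewrite -(mulKg a b) groupM ?groupV.
  have GN : G \subset 'N(V | 'P)%g by rewrite gen_subG subUset !sub1set aN.
  have : action.orbit 'P G x0 \subset V by rewrite acts_sub_orbit // inE.
  rewrite (atransP tr) ?inE // => /subsetP/(_ y0); rewrite !inE => /(_ isT).
  by rewrite (negPf (vw_dis _ y0w)).
pose O := action.orbit 'P G x0.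
have Oclos g x : g \in G -> x \in O -> g x \in O.
  move=> gG /orbitP[h hG <-]; apply/orbitP; exists (h * g)%g; first exact: groupM.
  by rewrite /= !apermE permM.
have cO x : x \in O -> (cyc v * cyc w)%g x \in O by apply: Oclos; rewrite -abE groupM.
have x0O : x0 \in O by apply: orbit_refl.
have vO : {subset v <= O}.
  apply: (cyc_closed_sub Uv x0v x0O) => x xv xO.
  by have [/(_ xv) <- _] := two_cycles_on x U; exact: cO.
have ax1w : a x1 \in w by have := vwT (a x1); rewrite mem_cat inE (negPf ax1).
have wO : {subset w <= O}.
  apply: (cyc_closed_sub Uw ax1w); first by apply: Oclos => //; exact: vO.
  by move=> x xw xO; have [_ /(_ xw) <-] := two_cycles_on x U; exact: cO.
apply/imsetP; exists x0; rewrite ?inE //; apply/setP => z; rewrite inE; apply/esym.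
by have := vwT z; rewrite mem_cat inE => /orP[/vO|/wO].
Qed.

Lemma invariant_two_cycles v w1 w2 : uniq v -> v != [::] ->
  uniq (w1 ++ w2) -> w1 ++ w2 =i predT -> size w2 = size v -> (size v <= size w1)%N ->
  all (fun x => (cyc w1 * cyc w2)%g x \in v) v =
    ([set x in w2] == [set x in v]) || ([set x in w1] == [set x in v]).
Proof.
move=> Uv v0 U wT sz2 sz1.
have U1 : uniq w1 by move: U; rewrite cat_uniq => /and3P[].
have U2 : uniq w2 by move: U; rewrite cat_uniq => /and3P[].
apply/allP/orP => [clos|[] /eqP/setP E x xv].
- have [x0 x0v] : exists x0, x0 \in v.
    by case: (v) v0 => // x l _; exists x; rewrite mem_head.
  have := wT x0; rewrite mem_cat inE => /orP[x0w|x0w].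
    have sub : {subset w1 <= v}.
      apply: (cyc_closed_sub U1 x0w x0v) => x xw xv.
      by have [/(_ xw) <- _] := two_cycles_on x U; exact: clos.
    have [_ E] := uniq_min_size U1 sub sz1.
    by right; apply/eqP/setP => x; rewrite !inE E.
  have sub : {subset w2 <= v}.
    apply: (cyc_closed_sub U2 x0w x0v) => x xw xv.
    by have [_ /(_ xw) <-] := two_cycles_on x U; exact: clos.
  have [|_ E] := uniq_min_size U2 sub; first by rewrite sz2.
  by left; apply/eqP/setP => x; rewrite !inE E.
- have {}E y : (y \in w2) = (y \in v) by have := E y; rewrite !inE.
  have [_ ->] := two_cycles_on x U; last by rewrite E.
  by rewrite -E cyc_mem E.
have {}E y : (y \in w1) = (y \in v) by have := E y; rewrite !inE.
have [->] := two_cycles_on x U; last by rewrite E.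
by rewrite -E cyc_mem E.
Qed.

End Transitivity.

(** * Sums over connected maps *)

Section ConnectedSums.
Variable T : finType.
Implicit Types (s t u a b c : {perm T}) (x y z : T) (v w : seq T).

Definition connected a c :=
  [transitive <<[set a; (a^-1 * c)%g]>>%g, on [set: T] | 'P].

Lemma shaped_two r p q c : shaped [set: T] r c -> perm_eq r [:: p; q] ->
  exists v w, [/\ size v = p, size w = q, c = (cyc v * cyc w)%g, uniq (v ++ w)
                & v ++ w =i predT].
Proof.
case=> bs [U bT <- _ ->] P.
have /mapP[v vbs szv] : p \in map size bs by rewrite (perm_mem P) mem_head.
have [rest pp] := mem_picks vbs; have Pbs := picks_perm pp.
have : perm_eq [:: q] (map size rest).
  rewrite -(perm_cons p) {2}szv -map_cons -(permPl P).
  exact: perm_map.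
rewrite perm_sym => /perm_small_eq-/(_ isT); case: rest pp Pbs => // w [] // pp Pbs [szw].
have PF := perm_flatten Pbs; rewrite /= cats0 in PF.
exists v, w; split=> //.
- by rewrite (cycs_picks U pp) /= /cycs big_seq1.
- by rewrite -(perm_uniq PF).
by move=> z; rewrite -(perm_mem PF) bT !inE.
Qed.

Lemma shapedJ r s u : shaped [set: T] r s -> shaped [set: T] r (s ^ u)%g.
Proof.
case=> bs [U bT szE r0 ->]; exists (map (map u) bs); rewrite -map_flatten; split=> //.
- by rewrite map_inj_uniq //; exact: perm_inj.
- move=> z; rewrite inE; apply/mapP; exists (u^-1 z)%g; rewrite ?permKV // bT inE //.
- by rewrite -szE -map_comp; apply: eq_map => l; rewrite /= size_map.
by rewrite cycsJ.
Qed.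

(** A set preserved by [s] is a union of its cycles, but each of these has more
elements than v. *)
Lemma large_cycle_leaves r s v : shaped [set: T] r s -> all (leq (size v).+1) r ->
  uniq v -> v != [::] -> ~~ all (fun x => s x \in v) v.
Proof.
case=> bs [U bT <- _ ->] /allP big Uv v0; apply/negP => /allP clos.
have [x0 x0v] : exists x0, x0 \in v.
  by case: (v) v0 => // x l _; exists x; rewrite mem_head.
have /flattenP[l lbs x0l] : x0 \in flatten bs by rewrite bT inE.
have [rest pp] := mem_picks lbs; have PF := perm_flatten (picks_perm pp).
rewrite /= in PF; have := U; rewrite (perm_uniq PF) cat_uniq => /and3P[Ul /hasPn dis _].
have sub : {subset l <= v}.
  apply: (cyc_closed_sub Ul x0l x0v) => x xl xv.
  have := clos x xv; rewrite (cycs_picks U pp) permM /= cycs_out //.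
  by apply/negP => /dis; rewrite cyc_mem xl.
have := big (size l) (map_f _ lbs); rewrite ltnNge => /negP; apply.
exact: uniq_leq_size.
Qed.

Lemma big_all_conj N c a : \sum_(u : {perm T}) N%:R ^+ ncyc (a ^ u * c^-1)%g =
  csum N [set: T] c a.
Proof.
apply: eq_bigl => u; rewrite in_Sym; apply/esym/subsetP => x _.
by rewrite inE.
Qed.

(** By [transitive_two_cycles], (a^u, c) is connected unless a^u preserves the p-cycle
of c. This is impossible if all the cycles of a are longer than p. If mu = [q, p]
it means that u carries one of the two cycles of a onto the p-cycle of c. The sum over
those u is the product of the one-cycle pairings, by [csum_matching], taken twice if
p = q, when either cycle can be used: this is the extra term in
[pairing_two_cycles]. *)
Theorem connected_sum N p q a c mu ra rc :
  (0 < p)%N -> (p <= q)%N -> (p <= N)%N ->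
  shaped [set: T] ra a -> shaped [set: T] rc c ->
  perm_eq rc [:: p; q] -> perm_eq ra mu -> sumn mu = (p + q)%N ->
  all (leq p.+1) mu \/ mu = [:: q; p] ->
  \sum_(u | connected (a ^ u)%g c) N%:R ^+ ncyc (a ^ u * c^-1)%g =
    (connpoly p q mu).[N%:R].
Proof.
move=> p0 pq pN sa sc Prc Pra smu muP.
have N0 : (0 < N)%N by apply: leq_trans pN.
have q0 : (0 < q)%N by apply: leq_trans pq.
have [v [w [szv szw cE U vwT]]] := shaped_two sc Prc.
have v0 : v != [::] by rewrite -size_eq0 szv -lt0n.
have w0 : w != [::] by rewrite -size_eq0 szw -lt0n.
have Uv : uniq v by move: U; rewrite cat_uniq => /and3P[].
have connE u : connected (a ^ u)%g c = ~~ all (fun x => (a ^ u)%g x \in v) v.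
  by apply: (transitive_two_cycles (w := w)) => //; rewrite mulKVg.
have total : \sum_(u : {perm T}) N%:R ^+ ncyc (a ^ u * c^-1)%g = pairing N [:: p; q] mu.
  rewrite big_all_conj (csum_pairing N0 sc sa) cardsT subnn mul1r.
  exact: pairing_perm.
case: muP => [mularge|muE].
  rewrite (eq_bigl xpredT); last first.
    move=> u; rewrite connE; apply: (@large_cycle_leaves ra) => //.
      exact: shapedJ sa.
    by rewrite (perm_all _ Pra) szv.
  by rewrite total pairing_large_parts.
have [||w2 [w1 [sz2 sz1 aE Uw wT]]] := @shaped_two ra p q a => //.
  by rewrite (perm_trans Pra) // muE (permPl (permEl (perm_catC [:: q] [:: p]))).
have aE' : a = (cyc w1 * cyc w2)%g.
  rewrite aE; apply: perm_on_commute (cyc_on w2) (cyc_on w1) _ => x; rewrite !inE.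
  by move: Uw; rewrite cat_uniq => /and3P[_ /hasPn dis _]; apply: contraL => /dis.
have Uw' : uniq (w1 ++ w2) by rewrite uniq_catC.
have wT' : w1 ++ w2 =i predT by move=> z; rewrite mem_cat orbC -mem_cat wT.
have split_sum : \sum_(u | connected (a ^ u)%g c) N%:R ^+ ncyc (a ^ u * c^-1)%g =
    pairing N [:: p; q] mu
    - \sum_(u | all (fun x => (a ^ u)%g x \in v) v) N%:R ^+ ncyc (a ^ u * c^-1)%g :> rat.
  rewrite -total [in RHS](bigID (fun u => all (fun x => (a ^ u)%g x \in v) v)) /=.
  by rewrite addrC addrK; apply: eq_bigl => u; rewrite connE.
have invE u : all (fun x => (a ^ u)%g x \in v) v =
    (u @: [set x in w2] == [set x in v]) || (u @: [set x in w1] == [set x in v]).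
  have imE l : u @: [set x in l] = [set x in map u l].
    apply/setP => z; rewrite inE; apply/imsetP/mapP => -[x]; rewrite ?inE => xl ->;
      by exists x; rewrite ?inE.
  rewrite !imE -invariant_two_cycles ?size_map ?sz2 ?szv ?sz1 //.
  - by rewrite aE' conjMg !cycJ.
  - by rewrite -map_cat map_inj_uniq //; exact: perm_inj.
  move=> z; rewrite -map_cat inE; apply/mapP; exists (u^-1 z)%g; last by rewrite permKV.
  exact: (wT' (u^-1 z)%g).
have first : \sum_(u : {perm T} | u @: [set x in w2] == [set x in v])
    N%:R ^+ ncyc (a ^ u * c^-1)%g = pairing N [:: p] [:: p] * pairing N [:: q] [:: q].
  rewrite -{1 2}szv -{1 2}szw -(csum_matching N0 v0 w0 U vwT Uw wT) ?sz2 ?szv //.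
  by rewrite -aE -cE.
rewrite split_sum (eq_bigl _ _ invE) muE pairing_two_cycles //.
have [pqE|npq] := eqVneq p q; last first.
  rewrite (eq_bigl (fun u : {perm T} => u @: [set x in w2] == [set x in v])).
    by rewrite first mul1r addrK.
  move=> u; rewrite [X in _ || X](_ : _ = false) ?orbF //; apply/negP => /eqP E.
  have := congr1 (fun A : {set T} => #|A|) E.
  rewrite card_imset; last exact: perm_inj.
  have card_seq l : uniq l -> #|[set x in l]| = size l.
    by move=> Ul; rewrite cardsE; apply/card_uniqP.
  rewrite !card_seq // ?sz1 ?szv; first by move=> E'; rewrite E' eqxx in npq.
  by move: Uw'; rewrite cat_uniq => /and3P[].
have second : \sum_(u : {perm T} | u @: [set x in w1] == [set x in v])
    N%:R ^+ ncyc (a ^ u * c^-1)%g = pairing N [:: p] [:: p] * pairing N [:: q] [:: q].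
  rewrite -{1 2}szv -{1 2}szw -(csum_matching N0 v0 w0 U vwT Uw' wT') ?sz1 ?szv //.
  by rewrite -aE' -cE.
rewrite (bigID (fun u : {perm T} => u @: [set x in w2] == [set x in v])) /=.
rewrite (eq_bigl (fun u : {perm T} => u @: [set x in w2] == [set x in v])); last first.
  by move=> u; case: (_ == _); rewrite ?andbF ?andbT.
rewrite first [X in _ - (_ + X)](eq_bigl (fun u : {perm T} => u @: [set x in w1] == [set x in v])).
  by rewrite second natrD mulrDl !mul1r addrK.
move=> u; case E2: (u @: [set x in w2] == _); rewrite ?andbT ?andbF //=; apply/esym.
apply/negP => /eqP E1; move/eqP: E2; rewrite -E1 => /imset_inj-/(_ (@perm_inj _ u)).
move=> /setP E; have [x xw2] : exists x, x \in w2.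
  by case: (w2) sz2 p0 => [<- //|x l _ _]; exists x; rewrite mem_head.
have := E x; rewrite !inE xw2 => /esym xw1.
move: Uw; rewrite cat_uniq => /and3P[_ /hasPn dis _].
by have := dis _ xw1; rewrite xw2.
Qed.

End ConnectedSums.

(** * Counting maps by genus *)

Lemma poly_eq_at_nat (P Q : {poly rat}) (m : nat) :
  (forall N : nat, (m <= N)%N -> P.[N%:R] = Q.[N%:R]) -> P = Q.
Proof.
move=> PQ; apply/eqP; rewrite -subr_eq0; apply/negPn/negP => PQ0.
pose rs : seq rat := [seq N%:R | N <- iota m (size (P - Q))].
have : (size rs < size (P - Q)%R)%N.
  apply: max_poly_roots => //.
    apply/allP => x /mapP[N]; rewrite mem_iota => /andP[mN _] ->.
    by rewrite /root !hornerE PQ // subrr.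
  rewrite map_inj_uniq ?iota_uniq //; exact: mulrIn (oner_neq0 _).
by rewrite size_map size_iota ltnn.
Qed.

Lemma two_partsE p n : (p <= n - p)%N -> two_parts p n = [:: (n - p)%N; p].
Proof.
move=> pn; rewrite /two_parts; apply: (@sorted_eq _ geq).
- by move=> x y z /=; lia.
- by move=> x y /=; lia.
- by apply: sort_sorted => x y /=; lia.
- by rewrite /= pn.
by rewrite perm_sort; exact: (permEl (perm_catC [:: p] [:: (n - p)%N])).
Qed.

Lemma size_le_sumn (mu : seq nat) : all (leq 1) mu -> (size mu <= sumn mu)%N.
Proof. by elim: mu => //= r mu IH /andP[r0 /IH]; lia. Qed.

Section Counting.
Variable n : nat.
Implicit Types (a b c s u : 'S_n).

Lemma cycle_typeJ s u : cycle_type (s ^ u)%g = cycle_type s.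
Proof.
apply/perm_sortP; [by move=> x y /=; lia | by move=> y x z /=; lia | by move=> x y /=; lia | ].
have PE : porbits (s ^ u)%g = (fun C : {set 'I_n} => u @: C) @: porbits s.
  apply/setP => C; apply/imsetP/imsetP => [[x _ ->]|[_ /imsetP[x _ ->] ->]].
    exists (porbit s (u^-1 x)%g); first exact: imset_f.
    by rewrite -porbitJ permKV.
  by exists (u x); rewrite ?porbitJ.
have PP : perm_eq (enum (porbits (s ^ u)%g)) [seq u @: (C : {set 'I_n}) | C <- enum (porbits s)].
  apply: uniq_perm; rewrite ?enum_uniq //.
    by rewrite map_inj_uniq ?enum_uniq //; apply: imset_inj; exact: perm_inj.
  move=> C; rewrite mem_enum PE; apply/imsetP/mapP => -[D]; rewrite ?mem_enum => DP ->;
    by exists D; rewrite ?mem_enum.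
apply: (perm_trans (perm_map _ PP)); rewrite -map_comp.
by rewrite (eq_map (_ : _ =1 (fun C : {set 'I_n} => #|C|))) // => C; rewrite /= card_imset //; exact: perm_inj.
Qed.

Lemma shaped_cycle_type s mu : cycle_type s == mu ->
  exists2 r, shaped [set: 'I_n] r s & perm_eq r mu.
Proof.
move/eqP <-; exists [seq #|C| | C : {set 'I_n} in porbits s]; first exact: shaped_porbits.
by rewrite perm_sym perm_sort.
Qed.

Lemma ncyc_cycle_type s : ncyc s = size (cycle_type s).
Proof. by rewrite size_sort size_image. Qed.

Lemma odd_ncyc s : odd (ncyc s) = odd n (+) odd_perm s.
Proof. by rewrite /odd_perm card_ord addKb. Qed.

Variables (p : nat) (mu : seq nat).

Definition typed_pairs : {set 'S_n * 'S_n} :=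
  [set ac : 'S_n * 'S_n | (cycle_type ac.1 == mu) && (cycle_type ac.2 == two_parts p n)].

Definition cycle_poly : {poly rat} :=
  \sum_(ac in typed_pairs | connected ac.1 ac.2) 'X^(ncyc (ac.1^-1 * ac.2)%g).

Definition map_count k : nat :=
  #|[set ac in typed_pairs | connected ac.1 ac.2 & ncyc (ac.1^-1 * ac.2)%g == k]|.

Lemma coef_cycle_poly k : cycle_poly`_k = (map_count k)%:R.
Proof.
rewrite coef_sum /map_count -sum1_card natr_sum big_mkcond [RHS]big_mkcond /=.
apply: eq_bigr => ac _; rewrite [in RHS]inE.
case: (ac \in typed_pairs) => //=; case: connected => //=.
by rewrite coefXn eq_sym; case: eqP.
Qed.

Hypotheses (p0 : (0 < p)%N) (pn : (p <= n - p)%N).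
Hypothesis smu : sumn mu = n.
Hypothesis mu1 : all (leq 1) mu.
Hypothesis muP : all (leq p.+1) mu \/ mu = [:: (n - p)%N; p].

(** Both sides agree at all the large N. Replacing [a] by its conjugates leaves the set
of pairs unchanged, so that summing over all u multiplies the polynomial by n!,
while for each pair [connected_sum] gives the same value. *)
Lemma cycle_poly_connpoly :
  (n`!)%:R *: cycle_poly = #|typed_pairs|%:R *: connpoly p (n - p) mu.
Proof.
apply: (@poly_eq_at_nat _ _ p) => N pN; rewrite !hornerZ.
pose F a c : rat := N%:R ^+ ncyc (a * c^-1)%g.
transitivity (\sum_(ac in typed_pairs) \sum_(u | connected (ac.1 ^ u)%g ac.2)
   F (ac.1 ^ u)%g ac.2); last first.
  rewrite -sum1_card natr_sum mulr_suml; apply: eq_bigr => -[a c].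
  rewrite inE /= => /andP[/shaped_cycle_type[ra sa Pa] /shaped_cycle_type[rc sc Pc]].
  rewrite mul1r; apply: (connected_sum p0 pn pN sa sc) => //.
    by rewrite (perm_trans Pc) // two_partsE // (permPl (permEl (perm_catC [:: _] [:: p]))).
  by rewrite smu; lia.
rewrite (exchange_big_dep xpredT) //=.
rewrite (eq_bigr (fun=> cycle_poly.[N%:R])).
  by rewrite sumr_const -card_Sn -[RHS]mulr_natl; congr (_%:R * _); apply: eq_card.
move=> u _; rewrite /cycle_poly horner_sum.
have cj_inj : injective (fun ac : 'S_n * 'S_n => ((ac.1 ^ u)%g, ac.2)).
  by move=> [a c] [a' c'] [/conjg_inj -> ->].
rewrite [RHS](reindex_inj cj_inj) /=; apply: eq_big => [[a c]|[a c] _] /=.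
  by rewrite !inE /= cycle_typeJ.
rewrite hornerXn /F -ncycV invMg invgK ncycC; congr (_ ^+ _).
Qed.

Lemma roots_on_line_cycle_poly : roots_on_line 0 (map_poly ratr cycle_poly).
Proof.
pose k : rat := #|typed_pairs|%:R / (n`!)%:R.
have -> : cycle_poly = k *: connpoly p (n - p) mu.
  have n0 : (n`!)%:R != 0 :> rat by rewrite pnatr_eq0 -lt0n fact_gt0.
  by rewrite /k mulrC -scalerA -cycle_poly_connpoly scalerA mulVf ?scale1r.
rewrite map_polyZ => z; rewrite scaler_eq0 negb_or => /andP[k0 nz].
by rewrite rootZ //; apply: connpoly_line => //; rewrite smu; lia.
Qed.

Let d := size mu.
Let e := odd (n - d).
Let m := (n - d)./2.

(** The sign of b = a^-1 c is determined by those of a and c, and the sign of a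
permutation by the parity of its number of cycles. *)
Lemma map_count_parity k : odd k != e -> map_count k = 0%N.
Proof.
move=> ke; apply: eq_card0 => -[a c]; rewrite !inE /=; apply/negP.
case/and3P=> /andP[/eqP ta /eqP tc] _ /eqP kE; case/negP: ke; apply/eqP.
have dn : (d <= n)%N by rewrite -smu; exact: size_le_sumn.
have := odd_ncyc a; have := odd_ncyc c; have := odd_ncyc (a^-1 * c)%g.
rewrite kE odd_permM odd_permV !ncyc_cycle_type ta tc two_partsE // -/d /e oddB //=.
by case: (odd k) (odd n) (odd d) (odd_perm a) (odd_perm c) => [] [] [] [] [].
Qed.

Lemma map_count_tp2 i j : (i <= j)%N ->
  (map_count (i.*2 + e) * map_count (j.+1.*2 + e)
    <= map_count (i.+1.*2 + e) * map_count (j.*2 + e))%N.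
Proof.
move=> ij.
have Pe k : odd k != e -> cycle_poly`_k = 0.
  by move=> ke; rewrite coef_cycle_poly map_count_parity.
have := tp2_of_imaginary_roots Pe roots_on_line_cycle_poly ij.
by rewrite /= !coef_cycle_poly -!natrM ler_nat.
Qed.

(** A connected map is determined by a and c. With d parts for a and two cycles for c,
the genus equation says that b has n - d - 2g cycles, and n - d = 2m + e. *)
Lemma bmaps_map_count g :
  bmaps p n mu g = if (g <= m)%N then map_count ((m - g).*2 + e) else 0%N.
Proof.
have dn : (d <= n)%N by rewrite -smu; exact: size_le_sumn.
have nE : n = (d + m.*2 + e)%N.
  by rewrite -addnA [(m.*2 + e)%N]addnC odd_double_half subnKC.
pose triple (ac : 'S_n * 'S_n) := (ac.1, (ac.1^-1 * ac.2)%g, ac.2).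
have triple_inj : injective triple by move=> [a c] [a' c']; rewrite /triple /= => -[-> _ ->].
pose S := [set ac in typed_pairs | connected ac.1 ac.2
             & (g <= m)%N && (ncyc (ac.1^-1 * ac.2)%g == (m - g).*2 + e)%N].
have -> : bmaps p n mu g = #|S|.
  rewrite -(card_imset _ triple_inj); apply: eq_card => -[[a b] c].
  have genusE a' c' : cycle_type a' == mu -> cycle_type c' == two_parts p n ->
      has_genus g a' (a'^-1 * c')%g c' =
      (g <= m)%N && (ncyc (a'^-1 * c')%g == (m - g).*2 + e)%N.
    move=> /eqP ta /eqP tc; rewrite /has_genus -[kappa a']/(ncyc a') -[kappa c']/(ncyc c').
    rewrite -[kappa _]/(ncyc (a'^-1 * c')%g) (ncyc_cycle_type a') (ncyc_cycle_type c') ta tc.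
    rewrite two_partsE //= -/d; move: (ncyc _) => k; lia.
  rewrite inE /connected_map /bicolored_map.
  apply/idP/imsetP => [/and4P[/andP[/eqP cE tr] hg tc ta]|[[a' c'] S' [-> -> ->]]].
    have bE : b = (a^-1 * c)%g by rewrite cE mulKg.
    exists (a, c); last by rewrite /triple bE.
    by rewrite !inE ta tc /connected /= -genusE // -bE tr hg.
  move: S'; rewrite !inE /= => /and3P[/andP[ta tc] co].
  by rewrite -genusE // => ->; rewrite mulKVg eqxx ta tc !andbT.
rewrite /map_count /S; case: (g <= m)%N => //=.
by apply: eq_card0 => ac; rewrite !inE /= !andbF.
Qed.

Lemma bmaps_tp2 g h : (g <= h)%N ->
  (bmaps p n mu g * bmaps p n mu h.+1 <= bmaps p n mu g.+1 * bmaps p n mu h)%N.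
Proof.
move=> gh; rewrite !bmaps_map_count.
have [hm|] := ltnP h m; last by rewrite muln0.
rewrite !(leq_trans _ hm) ?ltnS // ?(leq_trans gh) //.
have := @map_count_tp2 (m - h.+1) (m - g.+1) (leq_sub2l _ _).
rewrite !subnSK // ?(leq_ltn_trans gh) // [leqLHS]mulnC [leqRHS]mulnC; exact.
Qed.

Lemma bmaps_vanish g : (m < g)%N -> bmaps p n mu g = 0%N.
Proof. by rewrite bmaps_map_count ltnNge => /negbTE ->. Qed.

End Counting.

Theorem corollary4p5 (R : realType) (n p : nat) (mu : seq nat)
    (hp : (0 < p)%N) (hpn : (p <= n - p)%N)
    (hmu : is_partition n mu)
    (hparts : all (leq p.+1) mu \/ mu = two_parts p n) :
  log_concave (fun g : nat => ((bmaps p n mu g)%:R)%R : R) /\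
  unimodal (fun g : nat => ((bmaps p n mu g)%:R)%R : R).
Proof.
case/and3P: hmu => _ mu1 /eqP smu; rewrite two_partsE // in hparts.
have tp := bmaps_tp2 hp hpn smu mu1 hparts.
split; first exact: (log_concave_of_tp2 R tp).
apply: (@unimodal_of_tp2 R (bmaps p n mu) _ tp) => g.
exact: (bmaps_vanish hp).
Qed.
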